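(* Let $\mathcal{A}$ and $\mathcal{B}$ be uniform algebras on compact Hausdorff spaces $X$ and $Y$ respectively. Suppose that $S$ is a map from $\mathcal{A}$ onto $\mathcal{B}$ such that the inclusion $$\sigma_{\pi}(Sf\,Sg)\subset\sigma_{\pi}(fg)$$ holds for every pair $f$ and $g$ in $\mathcal{A}$. Then $(S1)^2=1$ and there exists a homeomorphism $\phi$ from $\mathrm{Ch}(\mathcal{B})$ onto $\mathrm{Ch}(\mathcal{A})$ such that the equality $$Sf(y)=S1(y)\,f(\phi(y)),\quad y\in\mathrm{Ch}(\mathcal{B})$$ holds for every $f\in\mathcal{A}$. In particular, $\frac{S}{S1}$ (the map $f\mapsto Sf/S1$) is an isometrical algebra isomorphism from $\mathcal{A}$ onto $\mathcal{B}$.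
   Context: A uniform algebra on a compact Hausdorff space $X$ is a uniformly closed subalgebra of $C(X)$ (complex-valued continuous functions) which contains the constants and separates the points of $X$. The peripheral spectrum of $f$ is $\sigma_{\pi}(f)=\{z\in\sigma(f):|z|=\mathrm{r}(f)\}$, where $\sigma(f)$ is the spectrum and $\mathrm{r}(f)$ the spectral radius. $\mathrm{Ch}(\mathcal{A})\subset X$ is the Choquet boundary of $\mathcal{A}$. $S$ is not assumed to be linear or multiplicative. *)

(* Defs.v *)
From HB Require Import structures.
From mathcomp Require Import all_boot all_order all_algebra.
From mathcomp Require Import all_classical all_reals all_analysis.
From mathcomp Require Export complex.

Set Implicit Arguments.
Unset Strict Implicit.
Unset Printing Implicit Defensive.

Import Order.TTheory GRing.Theory Num.Theory.
Import numFieldNormedType.Exports.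

Local Open Scope classical_set_scope.
Local Open Scope ring_scope.
Local Open Scope complex_scope.

(* The usual topology of the complex plane: MathComp-Analysis attaches the
   topology of the norm to K^o for every numFieldType K. *)
HB.instance Definition _ (R : rcfType) := NormedModule.copy R[i] R[i]^o.

Section UniformAlgebras.
Context {R : realType} {X : topologicalType}.
Implicit Types (A : set (X -> R[i])) (f : X -> R[i]) (L : (X -> R[i]) -> R[i]).

Record uniform_algebra A : Prop := UniformAlgebra {
  ua_continuous : forall f, A f -> continuous f;
  ua_cst : forall c : R[i], A (cst c);
  ua_add : forall f g, A f -> A g -> A (f + g);
  ua_scale : forall (c : R[i]) f, A f -> A (c *: f);
  ua_mul : forall f g, A f -> A g -> A (f * g);
  ua_separates : forall x y : X, x <> y -> exists2 f, A f & f x <> f y;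
  ua_closed : closed (A : set {uniform X -> R[i]}) }.

(* normc is the modulus with values in R (`|z| has values in R[i]). *)
Definition supnorm f : R := sup (range (fun x => Normc.normc (f x))).

(* The inverse is taken in A. *)
Definition spectrum A f : set R[i] :=
  [set z | ~ exists2 g, A g & (f - cst z) * g = 1].

Definition spectral_radius A f : R :=
  sup [set Normc.normc z | z in spectrum A f].

Definition peripheral_spectrum A f : set R[i] :=
  [set z | spectrum A f z /\ Normc.normc z = spectral_radius A f].

(* Functionals on A are represented by functionals on X -> R[i] of which only
   the values on A matter. A state is a functional with ||L|| = L 1 = 1; the
   inequality ||L|| >= 1 is a consequence of L 1 = 1. *)
Record state A L : Prop := State {
  state_linear : forall (c : R[i]) f g, A f -> A g ->
    L (c *: f + g) = c * L f + L g;
  state_bounded : forall f, A f -> Normc.normc (L f) <= supnorm f;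
  state_one : L 1 = 1 }.

Definition extreme_state A L : Prop :=
  state A L /\
  forall (t : R) L1 L2, 0 < t < 1 -> state A L1 -> state A L2 ->
    (forall f, A f -> L f = t%:C * L1 f + (1 - t)%:C * L2 f) ->
    forall f, A f -> L1 f = L f /\ L2 f = L f.

(* The points whose evaluation functional is an extreme point of the state
   space of A. *)
Definition choquet_boundary A : set X :=
  [set x | extreme_state A (fun f => f x)].

End UniformAlgebras.

Definition homeomorphism_on {X Y : topologicalType} (P : set X) (Q : set Y)
    (phi : X -> Y) : Prop :=
  [/\ set_fun P Q phi, {within P, continuous phi} &
    exists psi : Y -> X,
      [/\ set_fun Q P psi, {within Q, continuous psi},
          {in P, cancel phi psi} & {in Q, cancel psi phi}]].

Record isometric_algebra_isomorphism {R : realType} {X Y : topologicalType}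
    (A : set (X -> R[i])) (B : set (Y -> R[i]))
    (T : (X -> R[i]) -> (Y -> R[i])) : Prop := IsometricAlgebraIsomorphism {
  iai_bij : set_bij A B T;
  iai_add : forall f g, A f -> A g -> T (f + g) = T f + T g;
  iai_scale : forall (c : R[i]) f, A f -> T (c *: f) = c *: T f;
  iai_mul : forall f g, A f -> A g -> T (f * g) = T f * T g;
  iai_one : T 1 = 1;
  iai_isometry : forall f, A f -> supnorm (T f) = supnorm f }.

(* Main.v *)
Require Import Defs.
From mathcomp Require Import all_boot all_order all_algebra.
From mathcomp Require Import all_classical all_reals all_analysis.
From mathcomp Require Import ring lra.

(** A uniform algebra sees its peripheral spectra on points: the Neumann series
    shows that the peripheral spectrum of [f] is the set of values of [f] of
    maximal modulus. The hypothesis therefore says that every value of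
    [S f * S g] of maximal modulus is a value of [f * g] of maximal modulus; in
    particular [S f * S g] and [f * g] have the same norm.

    Such information is localized by peaking functions. Bishop's lemma
    ([bishop]) states that at a peak point [x], that is, a strong boundary
    point, any [f] in [A] with [f x != 0] can be multiplied by a [g] in [A] of
    norm [1] with [g x = 1] so that the norm of [f g] drops to [|f x|]. Two
    facts about peak points are used. First, they form a boundary
    ([peak_point_max]), by Zorn's lemma applied to intersections of peak sets.
    Second, every point of the Choquet boundary is one ([choquet_peak_point]):
    by the Hahn-Banach theorem the upper envelope at [x] of a bounded function
    is attained by a mean representing the evaluation at [x]; extremality of the
    evaluation forces this mean to be concentrated at [x]; hence there are
    functions in [A] whose real part is almost [0] at [x] and large away from
    [x], and [1 / (1 + f)] peaks near [x].

    Let [y] be a peak point of [B]. Comparing norms of products shows that the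
    sets of peak points of [A] where [|f| >= |S f y|], for [f] in [A], have the
    finite intersection property, and a point [x] in their closures satisfies
    [|f x| = |S f y|] for all [f] ([modulus_point]). Pulling back to [A] a
    function of [B] that damps [S f] at [y], one obtains [G] in [A] such that
    [1] and [f x] are the only values of maximal modulus of [G] and [f G]; the
    hypothesis for [(G, 1)] and [(f, G)] gives [S f y = S 1 y * f x]
    ([multiplier_at_peak]).

    Since peak points form a boundary, [S 1 ^+ 2 = 1] and [T = S / S 1] is an
    isometric algebra isomorphism. It transports extreme states, so [x] lies in
    the Choquet boundary of [A]; the same construction for the inverse of [T]
    gives the inverse of the map from [y] to [x], and both are continuous
    because the algebras determine the topologies. *)

Set Implicit Arguments.
Unset Strict Implicit.
Unset Printing Implicit Defensive.

Import Order.TTheory GRing.Theory Num.Theory.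
Import numFieldNormedType.Exports.

Local Open Scope classical_set_scope.
Local Open Scope ring_scope.
Local Open Scope complex_scope.

Import Normc.

(** * Moduli of complex numbers *)

Section ComplexNumbers.
Context {R : realType}.
Implicit Types (z w : R[i]) (r : R).

Lemma normc_ge0 z : 0 <= normc z.
Proof. by case: z => a b; exact: sqrtr_ge0. Qed.

Lemma normc_sqr z : normc z ^+ 2 = complex.Re z ^+ 2 + complex.Im z ^+ 2.
Proof. by case: z => a b /=; rewrite sqr_sqrtr// addr_ge0 ?sqr_ge0. Qed.

Lemma normcr r : normc r%:C = `|r|.
Proof. by rewrite /= expr0n/= addr0 sqrtr_sqr. Qed.

Lemma normc_Re z : `|complex.Re z| <= normc z.
Proof.
by rewrite -(@ler_pXn2r _ 2)// ?nnegrE ?normc_ge0// normc_sqr real_normK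
  ?num_real// lerDl sqr_ge0.
Qed.

Lemma normc_Im z : `|complex.Im z| <= normc z.
Proof.
by rewrite -(@ler_pXn2r _ 2)// ?nnegrE ?normc_ge0// normc_sqr real_normK
  ?num_real// lerDr sqr_ge0.
Qed.

Lemma normc_le_ReIm z : normc z <= `|complex.Re z| + `|complex.Im z|.
Proof.
rewrite -(@ler_pXn2r _ 2)// ?nnegrE ?normc_ge0// ?addr_ge0// normc_sqr.
by rewrite sqrrD !real_normK ?num_real// lerD2r lerDl mulrn_wge0// mulr_ge0.
Qed.

Lemma normcX z n : normc (z ^+ n) = normc z ^+ n.
Proof. by elim: n => [|n IH]; rewrite ?normc1// !exprS normcM IH. Qed.

Lemma normc_eq0 z : (normc z == 0) = (z == 0).
Proof. by apply/eqP/eqP => [/eq0_normc//|->]; rewrite normc0. Qed.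

Lemma ReD z w : complex.Re (z + w) = complex.Re z + complex.Re w.
Proof. by case: z w => a b [c d]. Qed.
Lemma ImD z w : complex.Im (z + w) = complex.Im z + complex.Im w.
Proof. by case: z w => a b [c d]. Qed.
Lemma ReN z : complex.Re (- z) = - complex.Re z.
Proof. by case: z. Qed.
Lemma ImN z : complex.Im (- z) = - complex.Im z.
Proof. by case: z. Qed.
Lemma ReM z w : complex.Re (z * w) =
  complex.Re z * complex.Re w - complex.Im z * complex.Im w.
Proof. by case: z w => a b [c d]. Qed.
Lemma ImM z w : complex.Im (z * w) =
  complex.Re z * complex.Im w + complex.Im z * complex.Re w.
Proof. by case: z w => a b [c d]. Qed.

Lemma complex_ext z w :
  complex.Re z = complex.Re w -> complex.Im z = complex.Im w -> z = w.
Proof. by case: z w => a b [c d] /= -> ->. Qed.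

Lemma le_normcB z w : normc z - normc w <= normc (z - w).
Proof. by rewrite lerBlDr (le_trans _ (le_normcD _ _))// subrK. Qed.

Lemma normc_distC z w : normc (z - w) = normc (w - z).
Proof. by rewrite -normcN opprB. Qed.

Lemma rotate_to_norm z : exists2 c, normc c = 1 & c * z = (normc z)%:C.
Proof.
have [->|z0] := eqVneq z 0; first by exists 1; rewrite ?normc1// mul1r normc0.
have n0 : normc z != 0 by rewrite normc_eq0.
exists ((normc z)%:C / z); last by rewrite mulfVK.
by rewrite normcM normcV normcr ger0_norm ?normc_ge0// divff.
Qed.

(** The parallelogram law makes the average of [1] and [z] strictly smaller than
    [1], unless [z = 1]. *)
Lemma normc_avg_lt1 z : normc z <= 1 -> z <> 1 -> normc ((1 + z) / 2) < 1.
Proof.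
move=> z1 /eqP zn1.
have zn1' : 0 < normc (1 - z) ^+ 2.
  by rewrite exprn_gt0// lt_def normc_ge0 normc_eq0 subr_eq0 eq_sym zn1.
have z2 : normc z ^+ 2 <= 1 by rewrite expr_le1// normc_ge0.
rewrite -(@ltr_pXn2r _ 2)// ?nnegrE ?normc_ge0// expr1n normcM normcV exprMn.
have -> : normc (2 : R[i]) = 2 by rewrite normcMn normc1.
move: zn1' z2; rewrite !normc_sqr !(ReD, ImD, ReN, ImN) /=.
by case: z {z1 zn1} => a b /= zn1 z2; lra.
Qed.

Lemma normc_avg_le1 z : normc z <= 1 -> normc ((1 + z) / 2) <= 1.
Proof.
move=> z1; have [->|/eqP zn1] := eqVneq z 1; last exact/ltW/normc_avg_lt1.
by rewrite divff ?normc1// pnatr_eq0.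
Qed.

Lemma avg_eq1 z : normc z <= 1 -> 1 <= normc ((1 + z) / 2) -> z = 1.
Proof.
move=> z1 az; apply: contrapT => zn1.
by have := normc_avg_lt1 z1 zn1; rewrite ltNge az.
Qed.

Lemma normcM_le1 z w : normc z <= 1 -> normc w <= 1 -> normc (z * w) <= 1.
Proof. by move=> z1 w1; rewrite normcM mulr_ile1 ?normc_ge0. Qed.

End ComplexNumbers.

(** * Closure properties of uniform algebras *)

Section UniformAlgebraBasics.
Context {R : realType} {X : topologicalType} (A : set (X -> R[i])).
Hypothesis uaA : uniform_algebra A.
Implicit Types (f g : X -> R[i]) (x : X).

Lemma ua_one : A 1.
Proof. exact: (ua_cst uaA 1). Qed.

Lemma ua_scalel c f : A f -> A (fun x => c * f x).
Proof. exact: (ua_scale uaA). Qed.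

Lemma ua_opp f : A f -> A (- f).
Proof.
move=> Af; suff -> : - f = -1 *: f by exact: ua_scale.
by rewrite scaleN1r.
Qed.

Lemma ua_sub f g : A f -> A g -> A (f - g).
Proof. by move=> Af Ag; apply: ua_add => //; exact: ua_opp. Qed.

Lemma ua_exp f n : A f -> A (f ^+ n).
Proof.
move=> Af; elim: n => [|n IH]; first exact: ua_one.
by rewrite exprS; exact: ua_mul.
Qed.

Lemma ua_continuous_normc f : A f -> continuous (fun x => normc (f x)).
Proof.
move=> Af x; apply/cvgrPdist_lt => e e0.
have e0' : 0 < e%:C by rewrite ltcR.
have /cvgrPdist_lt/(_ _ e0') : f @ x --> f x
  by exact: (@ua_continuous _ _ _ uaA _ Af x).
apply: filterS => y; rewrite -[ `|f x - f y| ]/((normc (f x - f y))%:C) ltcR.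
apply: le_lt_trans; rewrite ler_norml.
by rewrite lerNl opprB le_normcB normc_distC le_normcB.
Qed.

End UniformAlgebraBasics.

(** * Uniform limits and Neumann series *)

Section UniformLimits.
Context {R : realType} {X : topologicalType} {A : set (X -> R[i])}.
Hypothesis uaA : uniform_algebra A.
Implicit Types (f g : X -> R[i]) (x : X).

(** Closedness is stated for the uniform topology; this is its form with
    sup-norm approximations. *)
Lemma ua_uniform_closed f :
  (forall e : R, 0 < e -> exists2 g, A g & forall x, normc (f x - g x) < e) ->
  A f.
Proof.
move=> approx; have /closure_id -> := ua_closed uaA.
move=> B /uniform_nbhs[E [entE EB]].
move: entE; rewrite -entourage_ballE => -[e /= e0 eE].
move: (e0); rewrite ltcE => /andP[/eqP /= Ime Ree].
have [g Ag fg] := approx _ Ree; exists g; split=> //; apply: EB => y _ /=.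
apply: eE => /=;
  rewrite -ball_normE /= -[ `|f y - g y| ]/((normc (f y - g y))%:C).
by case: e e0 Ime Ree fg => a b /= _ -> _ fg; rewrite ltcR.
Qed.

(** The supremum of the lower bounds [a n - M n] serves as limit; it keeps the
    rate [M]. *)
Lemma real_limit_bound (a M : nat -> R) :
  (forall n m, (n <= m)%N -> `|a m - a n| <= M n) ->
  exists l, forall n, `|l - a n| <= M n.
Proof.
move=> aM.
have aub n m : a m - M m <= a n + M n.
  have M0 k : 0 <= M k by rewrite (le_trans _ (aM k k (leqnn k))).
  case: (leqP n m) => [nm|/ltnW nm].
    by have := aM _ _ nm; have := M0 m; rewrite ler_norml => ? /andP[]; lra.
  by have := aM _ _ nm; have := M0 n; rewrite ler_norml => ? /andP[]; lra.
exists (sup (range (fun n => a n - M n))) => n.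
have ne : range (fun n => a n - M n) !=set0 by exists (a 0%N - M 0%N), 0%N.
rewrite ler_norml; apply/andP; split.
  rewrite lerBrDr addrC; apply: ub_le_sup; last by exists n.
  by exists (a n + M n) => _ [m _ <-].
rewrite lerBlDr addrC; apply: ge_sup => //.
by move=> _ [m _ <-].
Qed.

(** The real and imaginary parts converge separately, hence the factor 2 in the
    rate. *)
Lemma ua_limit (u : nat -> X -> R[i]) (M : nat -> R) :
  (forall n, A (u n)) ->
  (forall n m x, (n <= m)%N -> normc (u m x - u n x) <= M n) ->
  (forall e, 0 < e -> exists n, M n < e) ->
  exists2 v, A v & forall n x, normc (v x - u n x) <= 2 * M n.
Proof.
move=> Au uM M0.
have limRe x : exists l, forall n, `|l - complex.Re (u n x)| <= M n.
  apply: real_limit_bound => n m nm; apply: le_trans (uM _ _ x nm).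
  by rewrite -ReN -ReD normc_Re.
have limIm x : exists l, forall n, `|l - complex.Im (u n x)| <= M n.
  apply: real_limit_bound => n m nm; apply: le_trans (uM _ _ x nm).
  by rewrite -ImN -ImD normc_Im.
have [re reP] := choice limRe; have [im imP] := choice limIm.
have bound n x : normc ((re x +i* im x) - u n x) <= 2 * M n.
  apply: le_trans (normc_le_ReIm _) _; rewrite !(ReD, ImD, ReN, ImN) /=.
  by have := reP x n; have := imP x n; lra.
exists (fun x => re x +i* im x) => //; apply: ua_uniform_closed => e e0.
have [n Mn] := M0 (e / 2) ltac:(by rewrite divr_gt0).
by exists (u n) => // x; apply: le_lt_trans (bound n x) _; lra.
Qed.

End UniformLimits.

Section Inverses.
Context {R : realType} {X : topologicalType} {A : set (X -> R[i])}.
Hypothesis uaA : uniform_algebra A.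
Implicit Types (f g q : X -> R[i]) (x : X) (r e : R).

Lemma expr_lt_eps r e : 0 <= r < 1 -> 0 < e -> exists n, r ^+ n < e.
Proof.
move=> /andP[r0 r1] e0.
have r1' : `|r| < 1 by rewrite ger0_norm.
have /cvgrPdist_lt/(_ _ e0)[n _ /(_ n (leqnn n))] := cvg_expr r1'.
by rewrite sub0r normrN ger0_norm ?exprn_ge0//; exists n.
Qed.

Lemma fct_expE f n x : (f ^+ n) x = f x ^+ n.
Proof. by elim: n => // n IH; rewrite !exprS -IH. Qed.

(** The Neumann series of [1 - q] converges uniformly to its pointwise
    inverse. *)
Lemma ua_inv1B q r : A q -> r < 1 -> (forall x, normc (q x) <= r) ->
  A (fun x => (1 - q x)^-1).
Proof.
move=> Aq r1 qr.
have [[x0 _]|noX] := pselect (exists x : X, True); last first.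
  apply: ua_uniform_closed => // e _; exists 1; first exact: ua_one.
  by move=> x; case: noX; exists x.
have r0 : 0 <= r by apply: le_trans (qr x0); exact: normc_ge0.
have dist x : 1 - r <= normc (1 - q x).
  by apply: le_trans (le_normcB _ _); rewrite normc1 lerD2l lerN2.
have geoA n : A (\sum_(k < n) q ^+ k).
  elim: n => [|n IH]; first by rewrite big_ord0; exact: (ua_cst uaA 0).
  by rewrite big_ord_recr; apply: ua_add => //; exact: ua_exp.
apply: ua_uniform_closed => // e e0.
have [n rn] : exists n, r ^+ n < e * (1 - r).
  by apply: expr_lt_eps; rewrite ?r0// mulr_gt0// subr_gt0.
exists (\sum_(k < n) q ^+ k) => // x.
have q1 : 1 - q x != 0.
  by rewrite -normc_eq0 gt_eqF// (lt_le_trans _ (dist x))// subr_gt0.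
have -> : (1 - q x)^-1 - (\sum_(k < n) q ^+ k) x = (1 - q x)^-1 * q x ^+ n.
  apply: (mulfI q1); rewrite mulrA mulfV// mul1r mulrBr mulfV//.
  have -> : (\sum_(k < n) q ^+ k) x = \sum_(k < n) q x ^+ k.
    by rewrite fct_sumE; apply: eq_bigr => k _; rewrite fct_expE.
  by rewrite -[1 - q x]opprB mulNr -subrX1 opprB opprD opprK addrA subrr add0r.
rewrite normcM normcV normcX mulrC ltr_pdivrMr; last first.
  by rewrite (lt_le_trans _ (dist x))// subr_gt0.
apply: le_lt_trans (lt_le_trans rn _); last by rewrite ler_pM2l.
by rewrite lerXn2r// ?nnegrE ?normc_ge0.
Qed.

End Inverses.

(** * Maximum modulus and the peripheral spectrum *)

Section CompactBase.
Context {R : realType} {X : topologicalType} {A : set (X -> R[i])}.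
Hypotheses (uaA : uniform_algebra A) (compX : compact [set: X]).
Implicit Types (f g q : X -> R[i]) (x : X) (r e : R).

Lemma max_modulus_on (K : set X) f : closed K -> K !=set0 -> A f ->
  exists2 x, K x & forall y, K y -> normc (f y) <= normc (f x).
Proof.
move=> clK K0 Af; have cK : compact K by apply: (subclosed_compact clK compX).
have cf : {within K, continuous (fun x => normc (f x))}.
  by apply: continuous_subspaceT => x;
    exact: (@ua_continuous_normc _ _ _ uaA _ Af x).
have [x xK xmax] := compact_EVT_max K0 cK cf.
exists x => [|y Ky]; first exact: set_mem.
exact/xmax/mem_set.
Qed.

Lemma ua_bound f : A f -> exists2 K : R, 1 <= K & forall x, normc (f x) <= K.
Proof.
move=> Af; have [X0|noX] := pselect ([set: X] !=set0); last first.
  by exists 1 => // x; case: noX; exists x.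
have [x _ xmax] := max_modulus_on closedT X0 Af.
exists (1 + normc (f x)) => [|y]; first by rewrite lerDl normc_ge0.
by rewrite (le_trans (xmax y I))// lerDr.
Qed.

(** For large [c], the disk of radius [c - 1/2] around [c] contains the values
    of [1 + f], so that the Neumann series of [(1 + f) / c] converges. *)
Lemma ua_invDRe f : A f -> (forall x, 0 <= complex.Re (f x)) ->
  A (fun x => (1 + f x)^-1).
Proof.
move=> Af Ref; have [K K1 fK] := ua_bound (ua_add uaA (ua_one uaA) Af).
pose c := K ^+ 2; have c1 : 1 <= c by rewrite exprn_ege1.
have c0 : 0 < c by exact: lt_le_trans c1.
pose q := 1 - c^-1%:C *: (1 + f).
have Aq : A q by apply: ua_sub => //; [exact: ua_one|apply: ua_scale => //;
  apply: ua_add => //; exact: ua_one].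
have qE x : q x = 1 - c^-1%:C * (1 + f x) by [].
have : A (fun x => (1 - q x)^-1).
  apply: (@ua_inv1B _ _ _ uaA q (1 - c^-1 / 2)) => //.
    by rewrite ltrBlDr ltrDl divr_gt0// invr_gt0.
  have ci1 : c^-1 <= 1 by rewrite invf_le1.
  have ci0 : 0 < c^-1 by rewrite invr_gt0.
  move=> x; rewrite -(@ler_pXn2r _ 2)// ?nnegrE ?normc_ge0//; last by lra.
  have : normc (1 + f x) ^+ 2 <= c.
    have K0 : 0 <= K by exact: le_trans K1.
    by apply: lerXn2r; rewrite ?nnegrE ?normc_ge0//; exact: fK.
  rewrite !normc_sqr qE !(ReD, ImD, ReN, ImN, ReM, ImM) /=.
  have := Ref x; move: (complex.Re (f x)) (complex.Im (f x)) => a b a0 ab.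
  have ab' : c^-1 * ((1 + a) ^+ 2 + (0 + b) ^+ 2) <= 1.
    by rewrite mulrC ler_pdivrMr// mul1r.
  rewrite !mul0r !subr0 !addr0.
  have : c^-1 * (c^-1 * ((1 + a) ^+ 2 + (0 + b) ^+ 2)) <= c^-1 * 1
    by rewrite ler_pM2l.
  have : 0 <= c^-1 * a by rewrite mulr_ge0// ltW.
  have : 0 <= c^-1 ^+ 2 by rewrite sqr_ge0.
  by move: (c^-1) => d; lra.
move=> Aq1; have := ua_scalel uaA c^-1%:C Aq1; congr (A _); apply/funext => x.
have dC : c^-1%:C != 0 by rewrite fmorph_eq0 gt_eqF// invr_gt0.
rewrite qE subKr; move: (c^-1%:C) dC => d dC.
by rewrite invfM mulrA mulfV ?mul1r.
Qed.

End CompactBase.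

Section PeripheralSpectrum.
Context {R : realType} {X : topologicalType} {A : set (X -> R[i])}.
Hypotheses (uaA : uniform_algebra A) (compX : compact [set: X]).
Hypothesis X0 : [set: X] !=set0.
Implicit Types (f g q : X -> R[i]) (x : X) (z : R[i]).

Lemma max_modulus f : A f -> exists x, forall y, normc (f y) <= normc (f x).
Proof.
move=> Af; have [x _ xmax] := max_modulus_on uaA compX closedT X0 Af.
by exists x => y; exact: xmax.
Qed.

Lemma supnormE f x : (forall y, normc (f y) <= normc (f x)) ->
  supnorm f = normc (f x).
Proof.
move=> xmax; apply/eqP; rewrite eq_le; apply/andP; split.
  by apply: ge_sup; [exists (normc (f x)), x|move=> _ [y _ <-]].
by apply: ub_le_sup; [exists (normc (f x)) => _ [y _ <-]|exists x].
Qed.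

Lemma range_spectrum f x : spectrum A f (f x).
Proof.
move=> [g Ag /(congr1 (fun h => h x))].
by rewrite /= !fctE subrr mul0r => /eqP; rewrite eq_sym oner_eq0.
Qed.

(** The Neumann series inverts [1 - q]; the norm of [q] is less than [1] because
    [q] attains its maximum modulus. *)
Lemma not_spectrum f z c q : A q -> c != 0 ->
  (forall x, f x - z = c * (1 - q x)) -> (forall x, normc (q x) < 1) ->
  ~ spectrum A f z.
Proof.
move=> Aq c0 fE q1 fz; apply: fz.
have [x xmax] := max_modulus Aq.
exists (c^-1 *: (fun x => (1 - q x)^-1)).
  by apply: (ua_scale uaA); exact: (ua_inv1B uaA Aq (q1 x)).
apply/funext => y; rewrite !fctE /cst.
have q0 : 1 - q y != 0.
  rewrite subr_eq0; apply/eqP => qy.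
  by have := q1 y; rewrite -qy normc1 ltxx.
by rewrite fE mulrACA mulfV// mulfV// mulr1.
Qed.

Lemma spectrum_le f x z : A f -> (forall y, normc (f y) <= normc (f x)) ->
  spectrum A f z -> normc z <= normc (f x).
Proof.
move=> Af xmax fz; rewrite leNgt; apply/negP => xz.
have z0 : z != 0 by rewrite -normc_eq0 gt_eqF// (le_lt_trans _ xz)// normc_ge0.
apply: (@not_spectrum f z (- z) (fun x => z^-1 * f x) _ _ _ _ fz).
- exact: ua_scalel.
- by rewrite oppr_eq0.
- by move=> y; rewrite mulrBr mulr1 mulNr mulrA mulfV// mul1r opprK addrC.
- move=> y; rewrite normcM normcV mulrC ltr_pdivrMr ?mul1r.
    exact: le_lt_trans (xmax y) xz.
  by rewrite (le_lt_trans _ xz)// normc_ge0.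
Qed.

(** If [z] has maximal modulus and is not a value of [f], then [(1 + f / z) / 2]
    has norm less than [1], so the Neumann series inverts [f - z]. *)
Lemma spectrum_max f x z : A f -> (forall y, normc (f y) <= normc (f x)) ->
  spectrum A f z -> normc z = normc (f x) -> exists y, f y = z.
Proof.
move=> Af xmax fz zx; apply: contrapT => nz.
have z0 : z != 0.
  rewrite -normc_eq0; apply/eqP => z0; apply: nz; exists x.
  by move: zx; rewrite z0 => /esym/eq0_normc ->; rewrite (eq0_normc z0).
apply: (@not_spectrum f z (-2 * z) (fun x =>
  2^-1 * (1 + z^-1 * f x)) _ _ _ _ fz).
- apply/(ua_scalel uaA)/(ua_add uaA); first exact: ua_one.
  exact: ua_scalel.
- by rewrite mulf_neq0// oppr_eq0 pnatr_eq0.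
- by move=> y; field.
- move=> y; rewrite mulrC; apply: normc_avg_lt1.
    rewrite normcM normcV mulrC ler_pdivrMr ?mul1r ?zx//.
    by rewrite -zx lt_def normc_ge0 normc_eq0 z0.
  move=> /(congr1 (fun w => z * w)); rewrite mulrA mulfV// mul1r mulr1 => fy.
  by apply: nz; exists y.
Qed.

(** In this form, an inclusion between peripheral spectra can be used point by
    point. *)
Lemma peripheral_spectrumP f z : A f ->
  peripheral_spectrum A f z <->
  (exists x, f x = z) /\ forall x, normc (f x) <= normc z.
Proof.
move=> Af; have [x xmax] := max_modulus Af.
have -> : peripheral_spectrum A f z <-> spectrum A f z /\ normc z = normc (f x).
  suff -> : normc (f x) = spectral_radius A f by [].
  apply/eqP; rewrite eq_le; apply/andP; split.
    apply: ub_le_sup; last by exists (f x) => //; exact: range_spectrum.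
    by exists (normc (f x)) => _ [w fw <-]; exact: spectrum_le fw.
  apply: ge_sup; first by exists (normc (f x)), (f x) => //;
    exact: range_spectrum.
  by move=> _ [w fw <-]; exact: spectrum_le fw.
split=> [[fz zx]|[[y <-] ymax]].
  by split; [exact: spectrum_max fz zx|move=> y; rewrite zx].
split; first exact: range_spectrum.
by apply/eqP; rewrite eq_le xmax ymax.
Qed.

End PeripheralSpectrum.

(** * Bishop's damping lemma *)

(** On a compact space, the closed sets with this property are the intersections
    of peak sets of [A], and a point is a strong boundary point, here called
    peak point, when its singleton has this property. Peaking functions are
    allowed to exceed [1] by [e], which is what approximations yield directly;
    Bishop's construction removes the excess. *)
Definition generalized_peak_set {R : realType} {X : topologicalType}
    (A : set (X -> R[i])) (E : set X) :=
  forall (U : set X) (e : R), open U -> E `<=` U -> 0 < e ->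
  exists g, [/\ A g, forall x, E x -> g x = 1,
    forall x, normc (g x) <= 1 + e & forall x, ~ U x -> normc (g x) <= e].

Section Bishop.
Context {R : realType} {X : topologicalType} {A : set (X -> R[i])}.
Hypotheses (uaA : uniform_algebra A) (compX : compact [set: X]).
Implicit Types (f g : X -> R[i]) (x : X) (E U : set X) (e : R).

Lemma open_modulus_lt f e : A f -> open [set x | normc (f x) < e].
Proof.
move=> Af; apply: (@open_comp _ _ (fun x => normc (f x)) [set r | r < e]).
  by move=> x _; exact: (@ua_continuous_normc _ _ _ uaA _ Af x).
exact: open_lt.
Qed.

Let t n : R := 2^-1 ^+ n.

Let t_gt0 n : 0 < t n. Proof. by rewrite exprn_gt0// invr_gt0. Qed.
Let t_le1 n : t n <= 1.
Proof. by rewrite exprn_ile1// ?invr_ge0// invf_le1// ler1n. Qed.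
Let tS n : t n.+1 = t n / 2. Proof. by rewrite /t exprSr. Qed.

Let le_limit (a b c : R) : (forall n, a <= b + c * t n) -> a <= b.
Proof.
move=> abc; apply/ler_addgt0Pr => e e0.
have c0 : 0 < `|c| + 1 by rewrite ltr_wpDl.
have [n tn] : exists n, t n < e / (`|c| + 1).
  by apply: expr_lt_eps; rewrite ?divr_gt0//; lra.
apply: le_trans (abc n) _; rewrite lerD2l.
move: tn; rewrite ltr_pdivlMr// => tn; have := ler_norm c; have := t_gt0 n; nra.
Qed.

(** Bishop's construction: [g n] peaks on [E] and is tiny wherever [f] or one of
    [g 0], ..., [g n.-1] exceeds [1 + d n] in modulus, and the sum of the
    [2^-(n+1) g n] is the desired function. At a given point, the partial sums
    are controlled by the bounds [1 + d n] until one of the functions is too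
    large there; from then on the increments are negligible. *)
Section Construction.
Variables (E : set X) (f : X -> R[i]) (K : R).
Hypotheses (Af : A f) (fE : forall x, E x -> normc (f x) <= 1).
Hypotheses (K1 : 1 <= K) (fK : forall x, normc (f x) <= K).
(* Small enough for [(1 - t n / 2) (1 + d n)^2] to stay below [1], and for [d n]
   to absorb a factor [|f| <= K]. *)
Let d n : R := t n / (8 * K).
Variable pick : set X * nat -> X -> R[i].
Hypothesis pickP : forall U n, open U -> E `<=` U ->
  [/\ A (pick (U, n)), forall x, E x -> pick (U, n) x = 1,
    forall x, normc (pick (U, n) x) <= 1 + d n &
    forall x, ~ U x -> normc (pick (U, n) x) <= d n].

(* The recursion produces the sets outside which [g n] has to be tiny. The bound
   [e] is left free because the same functions are compared with smaller bounds
   [1 + d n] at later stages. *)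
Let small := fix small n : R -> set X := if n is m.+1 then
    fun e => small m e `&`
      [set x | normc (pick (small m (1 + d m), m) x) < e]
  else fun e => [set x | normc (f x) < e].
Let g n := pick (small n (1 + d n), n).
Let u n : X -> R[i] := \sum_(k < n) (t k.+1)%:C *: g k.

Let d_gt0 n : 0 < d n.
Proof. by rewrite divr_gt0// mulr_gt0// (lt_le_trans ltr01). Qed.

Let dK n : d n * K = t n / 8.
Proof.
have K0 : K != 0 by rewrite gt_eqF// (lt_le_trans ltr01).
by rewrite /d; field.
Qed.

Let d_le n : d n <= t n / 8.
Proof. by rewrite -dK ler_peMr// ltW. Qed.

Let smallP n : forall e, 1 < e -> open (small n e) /\ E `<=` small n e.
Proof.
elim: n => [|n IH] e e1 /=.
  split; first exact: open_modulus_lt.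
  by move=> x /fE /le_lt_trans; apply.
have [on En] := IH _ e1.
have [|og Eg] := IH (1 + d n); first by rewrite ltrDl.
have [Ag g1 _ _] := pickP n og Eg.
split; first by apply: openI => //; exact: open_modulus_lt.
by move=> x Ex; split; [exact: En|rewrite /= g1// normc1].
Qed.

Let gP n : [/\ A (g n), forall x, E x -> g n x = 1,
    forall x, normc (g n x) <= 1 + d n &
    forall x, ~ small n (1 + d n) x -> normc (g n x) <= d n].
Proof. by have [|? ?] := @smallP n (1 + d n); [rewrite ltrDl|exact: pickP]. Qed.

Let uS n x : u n.+1 x = u n x + (t n.+1)%:C * g n x.
Proof. by rewrite /u big_ord_recr. Qed.

Let normc_t n (z : R[i]) : normc ((t n)%:C * z) = t n * normc z.
Proof. by rewrite normcM normcr ger0_norm// ltW. Qed.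

Let u_small n : forall e x, small n e x ->
  normc (f x) < e /\ normc (u n x) <= (1 - t n) * e.
Proof.
elim: n => [|n IH] e x /=.
  by rewrite /u big_ord0 normc0 /t expr0 subrr mul0r.
move=> [/IH[fe ue] ge]; split=> //; rewrite uS.
apply: le_trans (le_normcD _ _) _; rewrite normc_t tS.
have : t n * normc (g n x) <= t n * e by rewrite ler_pM2l// ltW.
by lra.
Qed.

(* The slack [3/8 * t n] pays for the points that leave [small n (1 + d n)]. *)
Let u_bound (w : R) x : 0 <= w <= K ->
  (forall n, small n (1 + d n) x -> w <= 1 + d n) ->
  forall n, normc (u n x) * w <= 1 - 3 / 8 * t n.
Proof.
move=> /andP[w0 wK] wsmall; elim=> [|n IH].
  by rewrite /u big_ord0 normc0 mul0r /t expr0; lra.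
have [_ _ g1 gd] := gP n.
apply: (@le_trans _ _ ((normc (u n x) + t n.+1 * normc (g n x)) * w)).
  by rewrite ler_wpM2r// uS (le_trans (le_normcD _ _))// normc_t.
have tn := t_gt0 n; have tn1 := t_le1 n; rewrite tS.
have [sx|/gd gx] := pselect (small n (1 + d n) x).
  have [_ ux] := u_small sx; have wd := wsmall _ sx; have gx := g1 x.
  have dn := d_gt0 n; have dle := d_le n.
  have gt : t n * normc (g n x) <= t n * (1 + d n) by rewrite ler_pM2l.
  apply: (@le_trans _ _ (((1 - t n / 2) * (1 + d n)) * (1 + d n))).
    by apply: ler_pM => //; [rewrite addr_ge0 ?mulr_ge0 ?normc_ge0 ?ltW//|];
      lra.
  have : d n * d n <= t n / 8 * (t n / 8) by apply: ler_pM => //; exact: ltW.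
  by nra.
have : normc (g n x) * w <= d n * K by apply: ler_pM => //; exact: normc_ge0.
by rewrite dK; nra.
Qed.

Let u_cauchy n m x : (n <= m)%N -> normc (u m x - u n x) <= 2 * (t n - t m).
Proof.
move=> nm; rewrite -(subnKC nm); elim: (m - n)%N => [|k IH].
  by rewrite addn0 !subrr normc0 mulr0.
rewrite addnS uS addrAC; apply: le_trans (le_normcD _ _) _.
rewrite normc_t tS; have [_ _ /(_ x) g1 _] := gP (n + k).
have g2 : normc (g (n + k) x) <= 2.
  by apply: le_trans g1 _; have := d_le (n + k); have := t_le1 (n + k); lra.
have := t_gt0 (n + k); nra.
Qed.

Lemma bishop_construction : exists g, [/\ A g, forall x, E x -> g x = 1,
  forall x, normc (g x) <= 1 & forall x, normc (f x * g x) <= 1].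
Proof.
have Au n : A (u n).
  rewrite /u; elim: n => [|n IH]; first by rewrite big_ord0;
    exact: (ua_cst uaA 0).
  rewrite big_ord_recr; apply: (ua_add uaA) => //; apply: (ua_scale uaA).
  by have [] := gP n.
have [||v Av vu] := @ua_limit _ _ _ uaA u (fun n => 2 * t n) Au.
- by move=> n m x nm; apply: le_trans (u_cauchy _ nm) _; have := t_gt0 m; lra.
- move=> e e0; have [n tn] : exists n, t n < e / 2.
    by apply: expr_lt_eps; rewrite ?divr_gt0//; lra.
  by exists n; lra.
have vbound (w : R) x : 0 <= w <= K ->
    (forall n, small n (1 + d n) x -> w <= 1 + d n) -> normc (v x) * w <= 1.
  move=> w0K ws; have /andP[w0 wK] := w0K.
  apply: (@le_limit _ _ (4 * K)) => n.
  have ub := u_bound w0K ws n; have vun := vu n x.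
  have vle : normc (v x) <= normc (v x - u n x) + normc (u n x).
    by apply: le_trans _ (le_normcD _ _); rewrite subrK.
  have tn := t_gt0 n.
  have : normc (v x) * w <= (2 * (2 * t n) + normc (u n x)) * w.
    by rewrite ler_wpM2r//; lra.
  by nra.
exists v; split=> //.
- move=> x Ex; apply/eqP; rewrite -subr_eq0 -normc_eq0 eq_le normc_ge0 andbT.
  apply: (@le_limit _ _ 5) => n.
  have un : u n x = 1 - (t n)%:C.
    elim: n => [|n IH]; first by rewrite /u big_ord0 /t expr0 subrr.
    have [_ /(_ _ Ex) g1 _ _] := gP n.
    rewrite uS IH g1 tS mulr1 -addrA; congr (_ + _).
    by apply: complex_ext => /=; lra.
  have -> : v x - 1 = (v x - u n x) - (t n)%:C.
    by rewrite un -addrA -opprD subrK.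
  apply: le_trans (le_normcD _ _) _; rewrite normcN normcr.
  by have := vu n x; rewrite gtr0_norm//; lra.
- move=> x; rewrite -[leLHS]mulr1; apply: vbound => [|n _].
    by rewrite ler01.
  by rewrite lerDl ltW.
- move=> x; rewrite normcM mulrC; apply: vbound => [|n sx].
    by rewrite normc_ge0 fK.
  by have [/ltW] := u_small sx.
Qed.

End Construction.

(** Applied to the singleton of a peak point [x], this localizes norms of
    products: the norm of [f g] is at most [c] as soon as [|f x| <= c]. *)
Lemma bishop E f (c : R) : generalized_peak_set A E -> A f -> 0 < c ->
  (forall x, E x -> normc (f x) <= c) ->
  exists g, [/\ A g, forall x, E x -> g x = 1,
    forall x, normc (g x) <= 1 & forall x, normc (f x * g x) <= c].
Proof.
move=> peakE Af c0 fc; pose f' x := c^-1%:C * f x.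
have Af' : A f' by exact: ua_scalel.
have f'E x : normc (f' x) = normc (f x) / c.
  by rewrite normcM normcr gtr0_norm ?invr_gt0// mulrC.
have [K K1 f'K] := ua_bound uaA compX Af'.
have K0 : 0 < 8 * K by rewrite mulr_gt0// (lt_le_trans ltr01).
have pick (p : set X * nat) : exists g, open p.1 -> E `<=` p.1 ->
    [/\ A g, forall x, E x -> g x = 1,
      forall x, normc (g x) <= 1 + t p.2 / (8 * K) &
      forall x, ~ p.1 x -> normc (g x) <= t p.2 / (8 * K)].
  have [[oU EU]|nU] := pselect (open p.1 /\ E `<=` p.1); last first.
    by exists 0 => oU EU; case: nU.
  have [g gP] := peakE p.1 (t p.2 / (8 * K)) oU EU (divr_gt0 (t_gt0 _) K0).
  by exists g.
have [G GP] := choice pick.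
have [|g [Ag g1 gle f'g]] := bishop_construction Af' _ K1 f'K (fun U n =>
  GP (U, n)).
  by move=> x Ex; rewrite f'E ler_pdivrMr ?mul1r ?fc.
exists g; split=> // x; have := f'g x.
by rewrite (normcM (f' x)) f'E (normcM (f x)) mulrAC ler_pdivrMr ?mul1r.
Qed.

(** Damping the approximate peaking function [h] gives the exact bound [1]. *)
Lemma peaking_function E U e : generalized_peak_set A E ->
  open U -> E `<=` U -> 0 < e ->
  exists g, [/\ A g, forall x, E x -> g x = 1,
    forall x, normc (g x) <= 1 & forall x, ~ U x -> normc (g x) <= e].
Proof.
move=> peakE oU EU e0; have [h [Ah h1 _ he]] := peakE _ _ oU EU e0.
have [x /h1 ->|g [Ag g1 gle hg]] := bishop peakE Ah ltr01;
  first by rewrite normc1.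
exists (h * g); split=> [|x Ex|x|x Ux]; first exact: ua_mul.
- by rewrite fctE h1// g1// mulr1.
- exact: hg.
- by rewrite fctE normcM -[leRHS]mulr1 ler_pM ?normc_ge0// he.
Qed.

End Bishop.

(** * Peak points form a boundary *)

Section Boundary.
Context {R : realType} {X : topologicalType} {A : set (X -> R[i])}.
Hypotheses (uaA : uniform_algebra A) (compX : compact [set: X]).
Implicit Types (f g : X -> R[i]) (x : X) (E U : set X) (e : R).

Lemma closed_level f c : A f -> closed [set x | f x = c].
Proof.
move=> Af; rewrite -[X in closed X]setCK; apply: open_closedC.
have -> : ~` [set x | f x = c] = [set x | 0 < normc (f x - c)].
  apply/seteqP; split=> x /=.
    by move=> /eqP fc; rewrite lt_def normc_ge0 normc_eq0 subr_eq0 fc.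
  by move=> + fc; rewrite fc subrr normc0 ltxx.
apply: (@open_comp _ _ (fun x => normc (f x - c)) [set r | 0 < r]).
  move=> x _; apply: (@ua_continuous_normc _ _ _ uaA (f - cst c) _ x).
  by apply: ua_sub => //; exact: (ua_cst uaA).
exact: open_gt.
Qed.

Lemma compact_directed (F : set (set X)) U : F !=set0 ->
  (forall E, F E -> closed E) ->
  (forall E1 E2, F E1 -> F E2 -> exists2 E, F E & E `<=` E1 `&` E2) ->
  open U -> \bigcap_(E in F) E `<=` U -> exists2 E, F E & E `<=` U.
Proof.
move=> [E0 FE0] clF dirF oU capU; apply: contrapT => noE.
have FF : ProperFilter (filter_from F (fun E => E `\` U)).
  apply: filter_from_proper; last first.
    move=> E FE; apply: contrapT => EU; apply: noE; exists E => // x Ex.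
    by apply: contrapT => Ux; apply: EU; exists x.
  apply: filter_from_filter; first by exists E0.
  move=> E1 E2 F1 F2; have [E FE E12] := dirF _ _ F1 F2.
  by exists E => // x [/E12[? ?] ?]; split.
have [p [_ clp]] := compX FF filterT.
have pE E : F E -> (E `\` U) p.
  move=> FE; have clEU : closed (E `\` U).
    by apply: closedI; [exact: clF|exact: open_closedC].
  by apply: clEU => B pB; apply: clp => //; exists E.
have [_] := pE _ FE0; apply; apply: capU => E /pE[]//.
Qed.

(** The function [h = (1 + f / f x0) / 2] equals [1] on the new set and has
    modulus less than [1] on the rest of [E]. Damped to a function [k] of norm
    [1], its powers are small on [E] away from the new set, and a function
    peaking on [E] takes care of the points away from [E]. *)
Lemma generalized_peak_level E f x0 : generalized_peak_set A E -> closed E ->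
  A f -> E x0 -> (forall x, E x -> normc (f x) <= normc (f x0)) ->
  generalized_peak_set A (E `&` [set x | f x = f x0]).
Proof.
move=> peakE clE Af Ex0 fmax.
have [f0|f0] := eqVneq (f x0) 0.
  suff -> : E `&` [set x | f x = f x0] = E by [].
  apply/seteqP; split=> [x []//|x Ex]; split=> //=.
  rewrite f0; apply/eqP; rewrite -normc_eq0 eq_le normc_ge0 andbT.
  by rewrite -(@normc0 R) -f0 fmax.
pose h x := 2^-1 * (1 + (f x0)^-1 * f x).
have Ah : A h.
  apply: (ua_scalel uaA); apply: (ua_add uaA (ua_one uaA)).
  exact: (ua_scalel uaA).
have fle1 x : E x -> normc ((f x0)^-1 * f x) <= 1.
  move=> Ex; rewrite normcM normcV mulrC ler_pdivrMr ?mul1r ?fmax//.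
  by rewrite lt_def normc_ge0 normc_eq0 f0.
have hle x : E x -> normc (h x) <= 1.
  by move=> Ex; rewrite /h mulrC; exact/normc_avg_le1/fle1.
have hlt x : E x -> f x <> f x0 -> normc (h x) < 1.
  move=> Ex fx; rewrite /h mulrC; apply: normc_avg_lt1; first exact: fle1.
  by move=> /(congr1 (fun w => f x0 * w)); rewrite mulrA mulfV// mul1r mulr1.
have h1 x : f x = f x0 -> h x = 1.
  by move=> fx; rewrite /h fx mulVf// mulVf// pnatr_eq0.
move=> U e oU E'U e0.
have [g [Ag g1 _ hg]] := bishop uaA compX peakE Ah ltr01 hle.
pose k := h * g.
have Ak : A k by exact: ua_mul.
have kE x : E x -> k x = h x by move=> Ex; rewrite /k fctE g1// mulr1.
have [EU0|EU0] := pselect ((E `&` ~` U) !=set0); last first.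
  have EU : E `<=` U.
    by move=> x Ex; apply: contrapT => Ux; apply: EU0; exists x.
  have [g' [Ag' g'1 g'le g'e]] := peakE _ _ oU EU e0.
  by exists g'; split=> // x [Ex _]; exact: g'1.
have clEU : closed (E `&` ~` U) by apply: closedI => //; exact: open_closedC.
have [x1 [Ex1 Ux1] x1max] := max_modulus_on uaA compX clEU EU0 Ak.
have kx1 : normc (k x1) < 1.
  by rewrite kE//; apply: hlt => // fx1; apply: Ux1; exact: E'U.
pose r := (1 + normc (k x1)) / 2; have k10 := normc_ge0 (k x1).
have [n rn] : exists n, r ^+ n < e.
  by apply: expr_lt_eps => //; apply/andP; rewrite /r; split; lra.
have oW : open ([set x | normc (k x) < r] `|` U).
  by apply: openU => //; exact: (open_modulus_lt uaA).
have EW : E `<=` [set x | normc (k x) < r] `|` U.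
  move=> x Ex; have [Ux|Ux] := pselect (U x); [by right|left => /=].
  have : normc (k x) <= normc (k x1) by exact: x1max.
  by rewrite /r; lra.
have [g2 [Ag2 g21 g2le g2e]] := peaking_function uaA compX peakE oW EW e0.
exists (k ^+ n * g2); split=> [|x [Ex /= fx]|x|x Ux].
- by apply: ua_mul => //; exact: ua_exp.
- by rewrite fctE fct_expE kE// h1// expr1n mul1r g21.
- rewrite fctE fct_expE normcM normcX -[leRHS]mulr1.
  apply: ler_pM; rewrite ?exprn_ge0 ?normc_ge0//.
  by rewrite (@le_trans _ _ 1)// ?exprn_ile1 ?normc_ge0 ?hg// lerDl ltW.
- rewrite fctE fct_expE normcM normcX.
  have [kr|kr] := ltP (normc (k x)) r.
    rewrite -[leRHS]mulr1; apply: ler_pM; rewrite ?exprn_ge0 ?normc_ge0//.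
    apply: le_trans (ltW rn); rewrite lerXn2r ?nnegrE ?normc_ge0//;
      last exact: ltW.
    by rewrite (le_trans _ (ltW kr))// normc_ge0.
  rewrite -[leRHS]mul1r; apply: ler_pM; rewrite ?exprn_ge0 ?normc_ge0//.
    by rewrite exprn_ile1 ?normc_ge0 ?hg.
  by apply: g2e => -[/= |//]; rewrite ltNge kr.
Qed.

Let good E := [/\ closed E, E !=set0 & generalized_peak_set A E].

Let good_chain (F : set (set X)) : F !=set0 -> F `<=` good ->
  total_on F subset -> good (\bigcap_(E in F) E).
Proof.
move=> F0 Fgood Ftot.
have small U : open U -> \bigcap_(E in F) E `<=` U -> exists2 E, F E & E `<=` U.
  move=> oU; apply: compact_directed => //; first by move=> E /Fgood[].
  move=> E1 E2 F1 F2; have [E12|E21] := Ftot _ _ F1 F2.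
    by exists E1 => // x Ex; split=> //; exact: E12.
  by exists E2 => // x Ex; split=> //; exact: E21.
split.
- by apply: closed_bigI => E /Fgood[].
- apply: contrapT => cap0; have [||E FE] := small set0.
  + exact: open0.
  + by move=> x capx; apply: cap0; exists x.
  + by have [_ [x Ex] _] := Fgood _ FE; move/(_ x Ex).
- move=> U e oU capU e0; have [E FE EU] := small U oU capU.
  have [_ _ peakE] := Fgood _ FE.
  have [g [Ag g1 gle ge]] := peakE _ _ oU EU e0.
  by exists g; split=> // x; move/(_ E FE); exact: g1.
Qed.

(** A minimal generalized peak set, provided by Zorn's lemma and compactness, is
    a single point: after subtraction of a constant, a function separating two
    of its points would attain its maximum modulus on a proper subset, which is
    again a generalized peak set. *)
Lemma minimal_peak_set E0 : closed E0 -> E0 !=set0 ->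
  generalized_peak_set A E0 ->
  exists2 x, E0 x & generalized_peak_set A [set x].
Proof.
move=> clE0 E0n peakE0.
pose P (V : set X) := good (~` V `&` E0).
have [F FP Ftot|V [[clE En peakE] Vmax]] := @Zorn_bigcup X P.
  have [F0|F0] := pselect (F !=set0); last first.
    suff -> : \bigcup_(V in F) V = set0 by rewrite /P setC0 setTI.
    by apply/seteqP; split=> // x [V FV]; case: F0; exists V.
  pose G := [set ~` V `&` E0 | V in F].
  have -> : P (\bigcup_(V in F) V) = good (\bigcap_(E in G) E).
    rewrite /P; congr good; apply/seteqP; split=> x.
      move=> [nx Ex] _ [V FV <-]; split=> // Vx; apply: nx; by exists V.
    move=> capx; split; last first.
      by have [V FV] := F0; have [] := capx _ (imageP _ FV).
    by move=> [V FV Vx]; have [] := capx _ (imageP _ FV).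
  apply: good_chain.
  - by have [V FV] := F0; exists (~` V `&` E0), V.
  - by move=> _ [V FV <-]; exact: FP.
  - move=> _ _ [V1 F1 <-] [V2 F2 <-].
    by have [V12|V21] := Ftot _ _ F1 F2; [right|left] => x [nx Ex];
      split=> // Vx; apply: nx; auto.
have [x1 Ex1] := En; have [Vx1 E0x1] := Ex1.
suff E1 : ~` V `&` E0 = [set x1] by exists x1 => //; rewrite -E1.
apply/seteqP; split=> [x2 Ex2|_ ->//].
apply: contrapT => /= x21; have [h Ah hx] := ua_separates uaA x21.
pose f := h - cst (h x1).
have Af : A f by apply: ua_sub => //; exact: ua_cst.
have [x0 Ex0 fmax] := max_modulus_on uaA compX clE (ex_intro _ _ Ex1) Af.
pose E' := (~` V `&` E0) `&` [set x | f x = f x0].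
apply: (Vmax (~` E')).
  split=> [x Vx [[nVx _] _]//|E'V].
  have /E'V// : (~` E') x1.
  move=> [_ /= fx1]; apply: hx.
  suff : f x2 = 0 by move/subr0_eq.
  apply/eqP; rewrite -normc_eq0 eq_le normc_ge0 andbT.
  by rewrite (le_trans (fmax _ Ex2))// -fx1 /f !fctE subrr normc0.
rewrite /P setCK.
have -> : E' `&` E0 = E' by apply/seteqP; split=> [x []//|x []]; case=> ? ?;
  do !split.
split; first by apply: closedI => //; exact: closed_level.
  by exists x0.
exact: generalized_peak_level.
Qed.

(** Peak points form a boundary: minimize inside the level set of [f] through a
    point of maximum modulus. *)
Lemma peak_point_max f : [set: X] !=set0 -> A f ->
  exists2 x, generalized_peak_set A [set x] &
    forall y, normc (f y) <= normc (f x).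
Proof.
move=> X0 Af; have [x0 x0max] := max_modulus uaA compX X0 Af.
have peakX : generalized_peak_set A [set: X].
  move=> U e _ XU e0; exists 1; split=> //; first exact: ua_one.
  - by move=> x; rewrite [X in normc X](_ : _ = 1)// normc1 lerDl ltW.
  - by move=> x Ux; have := XU x I.
have peakE := generalized_peak_level peakX closedT Af I (fun x _ => x0max x).
have [||x [_ /= fx] peakx] := minimal_peak_set _ _ peakE.
- by apply: closedI; [exact: closedT|exact: closed_level].
- by exists x0.
- by exists x => // y; rewrite fx.
Qed.

End Boundary.

(** * The Hahn-Banach theorem *)

Section HahnBanach.
Context {R : realType} {T : Type} {D : set (T -> R)}.
Implicit Types (u v w : T -> R) (p q : (T -> R) -> R) (c t : R).
Hypotheses (D_add : forall u v, D u -> D v -> D (u + v)).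
Hypotheses (D_scale : forall c u, D u -> D (c \*o u)).

Definition sublinear_on p :=
  (forall u v, D u -> D v -> p (u + v) <= p u + p v) /\
  (forall c u, 0 < c -> D u -> p (c \*o u) <= c * p u).

Let scaleN1 u : -1 \*o u = - u.
Proof. by apply/funext => x /=; rewrite mulN1r. Qed.

Let D_opp u : D u -> D (- u).
Proof. by move=> Du; rewrite -scaleN1; exact: D_scale. Qed.

Let D_zero u : D u -> D 0.
Proof. by move=> Du; rewrite -(subrr u); apply: D_add => //; exact: D_opp. Qed.

Lemma sublinear0 p : sublinear_on p -> D 0 -> p 0 = 0.
Proof.
move=> [padd pscale] D0; have h0 : 0 < 2^-1 :> R by rewrite invr_gt0.
have := pscale _ _ h0 D0; have := padd _ _ D0 D0; rewrite addr0.
have -> : 2^-1 \*o (0 : T -> R) = 0 by apply/funext => x /=; rewrite mulr0.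
by move=> ? ?; lra.
Qed.

Lemma sublinear_opp p u : sublinear_on p -> D u -> - p (- u) <= p u.
Proof.
move=> sp Du; have [padd _] := sp.
have := padd _ _ Du (D_opp Du); rewrite subrr sublinear0//; first by lra.
exact: D_zero Du.
Qed.

Lemma sublinear_scale p c u : sublinear_on p -> 0 <= c -> D u ->
  p (c \*o u) = c * p u.
Proof.
move=> sp; have [_ pscale] := sp; rewrite le_eqVlt => /orP[/eqP <-|c0] Du.
  have -> : 0 \*o u = 0 by apply/funext => x /=; rewrite mul0r.
  by rewrite mul0r sublinear0//; exact: D_zero Du.
apply/eqP; rewrite eq_le pscale//=.
have ci : 0 < c^-1 by rewrite invr_gt0.
have := pscale _ _ ci (D_scale c Du).
have -> : c^-1 \*o (c \*o u) = u.
  by apply/funext => x /=; rewrite mulrA mulVf ?mul1r// gt_eqF.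
by rewrite mulrC ler_pdivlMr// mulrC.
Qed.

(** The sublinear functional obtained from [p] by forcing the value at [- w] to
    be at most [- p w]; a minimal sublinear functional is therefore odd. *)
Definition tighten p w v :=
  inf [set p (v + t \*o w) - t * p w | t in [set t | 0 <= t]].

Let tighten_lb p w v : sublinear_on p -> D w -> D v ->
  lbound [set p (v + t \*o w) - t * p w | t in [set t | 0 <= t]] (- p (- v)).
Proof.
move=> sp Dw Dv _ [t /= t0 <-]; have [padd _] := sp.
rewrite -sublinear_scale// lerBrDr addrC lerBlDr.
have E : t \*o w = v + t \*o w + - v by rewrite addrC addKr.
rewrite [X in p X <= _]E; apply: padd; last exact: D_opp.
by apply: D_add => //; exact: D_scale.
Qed.

Let tighten_le p w v t : sublinear_on p -> D w -> D v -> 0 <= t ->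
  tighten p w v <= p (v + t \*o w) - t * p w.
Proof.
move=> sp Dw Dv t0; apply: ge_inf; last by exists t.
by exists (- p (- v)); exact: tighten_lb.
Qed.

Let le_tighten p w v m : (forall t, 0 <= t -> m <= p (v + t \*o w) - t * p w) ->
  m <= tighten p w v.
Proof.
move=> mle; apply: lb_le_inf;
  first by exists (p (v + 0 \*o w) - 0 * p w), 0 => /=.
by move=> _ [t /= t0 <-]; exact: mle.
Qed.

Lemma tighten_le_self p w v : sublinear_on p -> D w -> D v ->
  tighten p w v <= p v.
Proof.
move=> sp Dw Dv; apply: le_trans (tighten_le sp Dw Dv (lexx 0)) _.
rewrite mul0r subr0 [X in p X](_ : _ = v)//.
by apply/funext => x; rewrite !fctE /= mul0r addr0.
Qed.

Lemma tighten_opp p w : sublinear_on p -> D w -> tighten p w (- w) <= - p w.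
Proof.
move=> sp Dw; apply: le_trans (tighten_le sp Dw (D_opp Dw) ler01) _.
have -> : - w + 1 \*o w = 0.
  by apply/funext => x; rewrite !fctE /= mul1r addNr.
by rewrite sublinear0//; [lra|exact: D_zero Dw].
Qed.

Lemma tighten_sublinear p w : sublinear_on p -> D w ->
  sublinear_on (tighten p w).
Proof.
move=> sp Dw; have [padd pscale] := sp; split=> [u v Du Dv|c u c0 Du].
  rewrite -lerBlDr; apply: le_tighten => t t0.
  rewrite lerBlDr -lerBlDl; apply: le_tighten => s s0.
  rewrite lerBlDr.
  have ts0 : 0 <= t + s by exact: addr_ge0.
  apply: le_trans (tighten_le sp Dw (D_add Du Dv) ts0) _.
  have -> : u + v + (t + s) \*o w = (u + t \*o w) + (v + s \*o w).
    by apply/funext => x; rewrite !fctE /=; ring.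
  have := padd _ _ (D_add Du (D_scale t Dw)) (D_add Dv (D_scale s Dw)).
  by lra.
rewrite mulrC -ler_pdivrMr//; apply: le_tighten => t t0.
rewrite ler_pdivrMr//.
have ct0 : 0 <= c * t by rewrite mulr_ge0// ltW.
apply: le_trans (tighten_le sp Dw (D_scale c Du) ct0) _.
have -> : c \*o u + (c * t) \*o w = c \*o (u + t \*o w).
  by apply/funext => x; rewrite !fctE /=; ring.
by have := pscale _ _ c0 (D_add Du (D_scale t Dw)); lra.
Qed.

(** Zorn's lemma applies because the pointwise infimum of a chain is finite:
    each [q <= p] satisfies [- p (- u) <= q u]. *)
Lemma minimal_sublinear p : sublinear_on p -> exists q, [/\ sublinear_on q,
  forall u, D u -> q u <= p u &
  forall r, sublinear_on r -> (forall u, D u -> r u <= q u) ->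
    forall u, D u -> q u <= r u].
Proof.
move=> sp.
pose P q := sublinear_on q /\ forall u, D u -> q u <= p u.
pose below (q r : {q | P q}) := `[< forall u, D u -> sval r u <= sval q u >].
have pP : P p by split.
have [|a b c /asboolP ab /asboolP bc|C Ctot|q qmin] :=
  @ZL_preorder {q | P q} (exist _ p pP) below.
- by move=> a; apply/asboolP.
- by apply/asboolP => u Du; exact: le_trans (bc _ Du) (ab _ Du).
- have [[q0 Cq0]|C0] := pselect (C !=set0); last first.
    by exists (exist _ p pP) => a Ca; case: C0; exists a.
  pose m u := inf [set sval a u | a in C].
  have mle (a : {q | P q}) u : C a -> D u -> m u <= sval a u.
    move=> Ca Du; apply: ge_inf; last by exists a.
    exists (- p (- u)) => _ [b Cb <-]; have [sb bp] := svalP b.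
    by apply: le_trans (sublinear_opp sb Du); rewrite lerN2 bp//; exact: D_opp.
  have lem (x : R) u : (forall a : {q | P q}, C a -> x <= sval a u) -> x <= m u.
    move=> xle; apply: lb_le_inf; first by exists (sval q0 u), q0.
    by move=> _ [a Ca <-]; exact: xle.
  have mP : P m.
    split; last by move=> u Du; apply: le_trans (mle _ _ Cq0 Du) _;
      have [_] := svalP q0; exact.
    split=> [u v Du Dv|c u c0 Du].
      rewrite -lerBlDr; apply: (lem _ _) => a Ca; rewrite lerBlDr -lerBlDl.
      apply: (lem _ _) => b Cb; rewrite lerBlDr.
      have [/asboolP ab|/asboolP ba] := Ctot _ _ Ca Cb.
        have [[radd _] _] := svalP b.
        apply: le_trans (mle _ _ Cb (D_add Du Dv)) _.
        by apply: le_trans (radd _ _ Du Dv) _; rewrite addrC lerD2l ab.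
      have [[qadd _] _] := svalP a.
      apply: le_trans (mle _ _ Ca (D_add Du Dv)) _.
      by apply: le_trans (qadd _ _ Du Dv) _; rewrite addrC lerD2r ba.
    rewrite mulrC -ler_pdivrMr//; apply: (lem _ _) => a Ca;
      rewrite ler_pdivrMr// mulrC.
    apply: le_trans (mle _ _ Ca (D_scale c Du)) _.
    by have [[_ qscale] _] := svalP a; exact: qscale.
  by exists (exist _ m mP) => a Ca; apply/asboolP => u Du /=; exact: mle.
- have [sq qp] := svalP q; exists (sval q); split=> // r sr rq.
  have rP : P r by split=> // u Du; exact: le_trans (rq _ Du) (qp _ Du).
  by have /asboolP := qmin (exist _ r rP) (asboolT rq).
Qed.

(** Minimal sublinear functionals are linear; tightening [p] at [w] before
    minimizing pins the value at [w]. *)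
Lemma hahn_banach p w : sublinear_on p -> D w -> exists l, [/\
  forall u v, D u -> D v -> l (u + v) = l u + l v,
  forall c u, D u -> l (c \*o u) = c * l u,
  forall u, D u -> l u <= p u & l w = p w].
Proof.
move=> sp Dw; have [q [sq qp qmin]] :=
  minimal_sublinear (tighten_sublinear sp Dw).
have qN u : D u -> q (- u) = - q u.
  move=> Du; apply/eqP; rewrite eq_le; apply/andP; split.
    apply: le_trans (tighten_opp sq Du); apply: qmin (D_opp Du).
      exact: tighten_sublinear.
    by move=> v Dv; exact: tighten_le_self.
  by rewrite lerNl; exact: sublinear_opp.
have qle u : D u -> q u <= p u.
  by move=> Du; apply: le_trans (qp _ Du) (tighten_le_self sp Dw Du).
have [qadd _] := sq.
exists q; split=> // [u v Du Dv|c u Du|].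
- apply/eqP; rewrite eq_le qadd//=.
  have := qadd _ _ (D_add Du Dv) (D_opp Dv); rewrite addrK qN//.
  by rewrite lerBrDr.
- have [c0|c0] := leP 0 c; first exact: sublinear_scale.
  have -> : c \*o u = - ((- c) \*o u).
    by apply/funext => x; rewrite !fctE /= mulNr opprK.
  rewrite qN ?sublinear_scale ?mulNr ?opprK// ?oppr_ge0 ?ltW//.
  exact: D_scale.
- apply/eqP; rewrite eq_le qle//= -lerN2 -qN//.
  by apply: le_trans (qp _ (D_opp Dw)) (tighten_opp sp Dw).
Qed.

End HahnBanach.

(** * Choquet boundary points are peak points *)

Section States.
Context {R : realType} {X : topologicalType} {A : set (X -> R[i])}.
Hypotheses (uaA : uniform_algebra A) (compX : compact [set: X]).
Implicit Types (f g : X -> R[i]) (x : X) (L : (X -> R[i]) -> R[i]).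

Lemma le_supnorm f x : A f -> normc (f x) <= supnorm f.
Proof.
move=> Af; have [K _ fK] := ua_bound uaA compX Af.
by apply: ub_le_sup; [exists K => _ [y _ <-]|exists x].
Qed.

Lemma eval_state x : state A (fun f => f x).
Proof. by split=> // f Af; exact: le_supnorm. Qed.

End States.

Section ChoquetPeak.
Context {R : realType} {X : topologicalType} {A : set (X -> R[i])}.
Hypotheses (uaA : uniform_algebra A) (compX : compact [set: X]).
Implicit Types (f g : X -> R[i]) (u v w : X -> R).

Definition bounded_functions : set (X -> R) :=
  [set u | exists K, forall z, `|u z| <= K].
Local Notation D := bounded_functions.

Let D_add u v : D u -> D v -> D (u + v).
Proof.
move=> [K uK] [M vM]; exists (K + M) => z.
by rewrite (le_trans (ler_normD _ _))// lerD.
Qed.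

Let D_scale (c : R) u : D u -> D (c \*o u).
Proof. by move=> [K uK]; exists (`|c| * K) => z /=;
  rewrite normrM ler_wpM2l. Qed.

Let D_mul u v : D u -> D v -> D (u * v).
Proof.
move=> [K uK] [M vM]; exists (K * M) => z.
by rewrite fctE normrM ler_pM.
Qed.

Let D_cst (c : R) : D (cst c). Proof. by exists `|c|. Qed.

Let D_Re f : A f -> D (fun z => complex.Re (f z)).
Proof.
move=> Af; have [K _ fK] := ua_bound uaA compX Af.
by exists K => z; apply: le_trans (fK z); exact: normc_Re.
Qed.

Lemma Re_mulNi f : (fun z => complex.Re ((- 'i) * f z)) = (fun z =>
  complex.Im (f z)).
Proof. by apply/funext => z;
  rewrite ReM /= !oppr0 mul0r sub0r mulN1r opprK. Qed.

Let D_Im f : A f -> D (fun z => complex.Im (f z)).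
Proof. by move=> Af; rewrite -Re_mulNi; apply/D_Re/(ua_scalel uaA). Qed.

(** The linear functionals below this sublinear functional are the means
    (finitely additive probability measures) that represent the evaluation at
    [x]. *)
Definition upper_envelope x u :=
  inf [set complex.Re (f x) | f in [set f | A f /\ forall z, u z
    <= complex.Re (f z)]].
Local Notation Q := upper_envelope.

Lemma upper_envelope_le x u f : A f -> (forall z, u z <= complex.Re (f z)) ->
  Q x u <= complex.Re (f x).
Proof.
move=> Af uf; apply: ge_inf; last by exists f.
by exists (u x) => _ [g [_ ug] <-].
Qed.

Lemma upper_envelope_ge x u (c : R) : D u ->
  (forall f, A f -> (forall z, u z <= complex.Re (f z)) ->
    c <= complex.Re (f x)) ->
  c <= Q x u.
Proof.
move=> [K uK] cle; apply: lb_le_inf => [|_ [f [Af uf] <-]]; last exact: cle.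
exists K, (cst K%:C) => //; split; first exact: ua_cst.
by move=> z /=; rewrite (le_trans (ler_norm _)).
Qed.

Lemma upper_envelope_sublinear x : sublinear_on (D:=D) (Q x).
Proof.
split=> [u v Du Dv|c u c0 Du].
  rewrite -lerBlDr; apply: upper_envelope_ge => // f Af uf.
  rewrite lerBlDr -lerBlDl; apply: upper_envelope_ge => // g Ag vg.
  rewrite lerBlDl -ReD.
  by apply: (upper_envelope_le x (ua_add uaA Af Ag)) => z; rewrite ReD lerD.
rewrite mulrC -ler_pdivrMr//; apply: upper_envelope_ge => // f Af uf.
rewrite ler_pdivrMr//.
have cf z : complex.Re (c%:C * f z) = complex.Re (f z) * c.
  by rewrite ReM /= mul0r subr0 mulrC.
rewrite -cf; apply: (upper_envelope_le x (ua_scalel uaA c%:C Af)) => z.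
by rewrite cf /= mulrC ler_pM2r.
Qed.

Section RepresentingFunctional.
Variables (x : X) (l : (X -> R) -> R).
Hypothesis chx : choquet_boundary A x.
Hypothesis lD : forall u v, D u -> D v -> l (u + v) = l u + l v.
Hypothesis lZ : forall c u, D u -> l (c \*o u) = c * l u.
Hypothesis lQ : forall u, D u -> l u <= Q x u.

Let l_le u (c : R) : D u -> (forall z, u z <= c) -> l u <= c.
Proof.
move=> Du uc; apply: le_trans (lQ Du) _.
by apply: (@upper_envelope_le x u (cst c%:C)) => //; exact: ua_cst.
Qed.

Let lN u : D u -> l (- u) = - l u.
Proof.
move=> Du; have -> : - u = (-1) \*o u by apply/funext => z /=; rewrite mulN1r.
by rewrite lZ// mulN1r.
Qed.

Let l_ge u (c : R) : D u -> (forall z, c <= u z) -> c <= l u.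
Proof.
move=> Du cu; rewrite -lerN2 -lN//; apply: l_le => [|z]; last by rewrite lerN2.
by have := D_scale (-1) Du; congr D; apply/funext => z /=; rewrite mulN1r.
Qed.

Let l_mono u v : D u -> D v -> (forall z, u z <= v z) -> l u <= l v.
Proof.
move=> Du Dv uv.
have DN : D (- u).
  by have := D_scale (-1) Du; congr D; apply/funext => z /=; rewrite mulN1r.
have : 0 <= l (v + - u).
  by apply: l_ge => [|z]; [exact: D_add|rewrite !fctE subr_ge0].
by rewrite lD// lN// subr_ge0.
Qed.

Let l_cst (c : R) : l (cst c) = c.
Proof. by apply/eqP; rewrite eq_le l_le ?l_ge. Qed.

Let l_Re f : A f -> l (fun z => complex.Re (f z)) = complex.Re (f x).
Proof.
move=> Af; have Df := D_Re Af; apply/eqP; rewrite eq_le; apply/andP; split.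
  by apply: le_trans (lQ Df) _; exact: upper_envelope_le.
rewrite -lerN2 -lN// -ReN.
have DN : D (- (fun z => complex.Re (f z))).
  by have := D_scale (-1) Df; congr D; apply/funext => z /=; rewrite mulN1r.
apply: le_trans (lQ DN) _.
apply: (upper_envelope_le x (ua_opp uaA Af)) => z.
by rewrite !fctE ReN.
Qed.

Let l_Im f : A f -> l (fun z => complex.Im (f z)) = complex.Im (f x).
Proof.
move=> Af; rewrite -Re_mulNi l_Re; last exact: ua_scalel.
by rewrite (congr1 (fun h => h x) (Re_mulNi f)).
Qed.

Let weighted w f : R[i] :=
  l (w * (fun z => complex.Re (f z))) +i* l (w * (fun z => complex.Im (f z))).

Let weighted_linear w (c : R[i]) f g : D w -> A f -> A g ->
  weighted w (c *: f + g) = c * weighted w f + weighted w g.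
Proof.
move=> Dw Af Ag.
have [Rf If Rg Ig] := And4 (D_mul Dw (D_Re Af)) (D_mul Dw (D_Im Af))
  (D_mul Dw (D_Re Ag)) (D_mul Dw (D_Im Ag)).
apply: complex_ext; rewrite ?(ReD, ImD, ReM, ImM) /=.
  have -> : w * (fun z => complex.Re ((c *: f + g) z)) =
      (complex.Re c \*o (w * (fun z => complex.Re (f z))) +
       (- complex.Im c) \*o (w * (fun z => complex.Im (f z)))) +
      w * (fun z => complex.Re (g z)).
    by apply/funext => z; rewrite !fctE ReD ReM /=; ring.
  by rewrite !lD ?lZ//; [ring|exact: D_scale|exact: D_scale|apply: D_add;
    exact: D_scale].
have -> : w * (fun z => complex.Im ((c *: f + g) z)) =
    (complex.Re c \*o (w * (fun z => complex.Im (f z))) +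
     complex.Im c \*o (w * (fun z => complex.Re (f z)))) +
    w * (fun z => complex.Im (g z)).
  by apply/funext => z; rewrite !fctE ImD ImM /=; ring.
by rewrite !lD ?lZ//; [exact: D_scale|exact: D_scale|apply: D_add;
  exact: D_scale].
Qed.

Let weighted_state w : D w -> (forall z, 0 <= w z) -> 0 < l w ->
  state A (fun f => (l w)^-1%:C * weighted w f).
Proof.
move=> Dw w0 lw0.
have wZ c f : A f -> weighted w (c *: f) = c * weighted w f.
  move=> Af; have A0 : A 0 by exact: (ua_cst uaA 0).
  have := weighted_linear c Dw Af A0; rewrite addr0 => ->.
  suff -> : weighted w 0 = 0 by rewrite addr0.
  have := weighted_linear 1 Dw A0 A0; rewrite scale1r addr0 mul1r.
  by move=> /esym/eqP; rewrite -subr_eq0 addrK => /eqP.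
split=> [c f g Af Ag|f Af|].
- by rewrite weighted_linear//; ring.
- have [c c1 cf] := rotate_to_norm (weighted w f).
  have Acf : A (c *: f) by exact: ua_scale.
  rewrite normcM normcr gtr0_norm ?invr_gt0// mulrC ler_pdivrMr//.
  have -> : normc (weighted w f) = l (w * (fun z => complex.Re ((c *: f) z))).
    by have := wZ c f Af; rewrite cf => /(congr1 (@complex.Re R)) /= <-.
  rewrite -lZ//; apply: l_mono => [||z].
  + by apply: D_mul => //; exact: D_Re.
  + exact: D_scale.
  rewrite !fctE /= mulrC ler_wpM2r//.
  apply: le_trans (ler_norm _) _; apply: le_trans (normc_Re _) _.
  by rewrite normcM c1 mul1r; exact: (le_supnorm uaA compX).
- have -> : weighted w 1 = (l w)%:C.
    apply: complex_ext => /=.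
      by congr l; apply/funext => z; rewrite !fctE mulr1.
    rewrite -[RHS](l_cst 0); congr l; apply/funext => z.
    by rewrite !fctE mulr0.
  by rewrite fmorphV mulVf// fmorph_eq0 gt_eqF.
Qed.

(** The functionals [f |-> l (w f) / l w] and [f |-> l ((1 - w) f) / l (1 - w)]
    are states, and the evaluation at [x] is their convex combination with
    weights [l w] and [1 - l w]; so both equal the evaluation at [x]. The bounds
    on [w] keep the weights positive. *)
Let weighted_third w f : A f -> (forall z, 3^-1 <= w z <= 2 / 3) ->
  l (w * (fun z => complex.Re (f z))) = l w * complex.Re (f x).
Proof.
move=> Af wb.
have Dw : D w.
  by exists 1 => z; have /andP[? ?] := wb z; rewrite ler_norml; apply/andP;
    split; lra.
pose w' := cst 1 + (-1) \*o w.
have Dw' : D w' by apply: D_add => //; exact: D_scale.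
have lw' : l w' = 1 - l w by rewrite lD ?lZ ?l_cst ?mulN1r//; exact: D_scale.
have lw1 : 3^-1 <= l w by apply: l_ge => // z; have /andP[] := wb z.
have lw2 : l w <= 2 / 3 by apply: l_le => // z; have /andP[] := wb z.
have s1 : state A (fun f => (l w)^-1%:C * weighted w f).
  by apply: weighted_state => // [z|]; [have /andP[? ?] := wb z|]; lra.
have s2 : state A (fun f => (l w')^-1%:C * weighted w' f).
  apply: weighted_state => // [z|]; last by rewrite lw'; lra.
  by rewrite /w' !fctE /=; have /andP[? ?] := wb z; lra.
have t01 : 0 < l w < 1 by apply/andP; split; lra.
have [_ /(_ _ _ _ t01 s1 s2)] := chx.
have lw0 : (l w)%:C != 0 by rewrite fmorph_eq0 gt_eqF//; lra.
have lw'0 : (l w')%:C != 0 by rewrite fmorph_eq0 gt_eqF// lw'; lra.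
have cancel_l (c : R) (z : R[i]) : c%:C != 0 -> c%:C * (c^-1%:C * z) = z.
  by move=> c0; rewrite mulrA fmorphV mulfV// mul1r.
case/(_ _ f Af) => [g Ag|L1f _].
  rewrite -lw' !cancel_l//.
  have [Rg Ig] := conj (D_Re Ag) (D_Im Ag).
  apply: complex_ext; rewrite ?(ReD, ImD) /=.
    rewrite -(l_Re Ag) -lD; [|exact: D_mul|exact: D_mul].
    by congr l; apply/funext => z; rewrite /w' !fctE /=; ring.
  rewrite -(l_Im Ag) -lD; [|exact: D_mul|exact: D_mul].
  by congr l; apply/funext => z; rewrite /w' !fctE /=; ring.
have := congr1 (fun z => (l w)%:C * z) L1f; rewrite cancel_l//.
by move=> /(congr1 (@complex.Re R)); rewrite ReM /= mul0r subr0.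
Qed.

(** An affine change of [v] brings it between [1/3] and [2/3]. *)
Let weighted_multiplicative v f : A f -> D v ->
  l (v * (fun z => complex.Re (f z))) = l v * complex.Re (f x).
Proof.
move=> Af Dv; have [K vK] := Dv.
pose M := 1 + `|K|; have M1 : 1 <= M by rewrite lerDl.
have vM z : `|v z| <= M.
  by rewrite (le_trans (vK z))// (le_trans (ler_norm K))// lerDr.
pose c := (6 * M)^-1.
have M6 : 0 < 6 * M by lra.
have c0 : c != 0 by rewrite invr_eq0 gt_eqF.
have cv z : `|c * v z| <= 6^-1.
  rewrite normrM gtr0_norm ?invr_gt0// mulrC ler_pdivrMr// mulrA mulVf ?mul1r
    ?pnatr_eq0//.
pose w := cst 2^-1 + c \*o v.
have wb z : 3^-1 <= w z <= 2 / 3.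
  by have := cv z; rewrite /w !fctE /= ler_norml => /andP[? ?]; apply/andP;
    split; lra.
have := weighted_third Af wb.
have Df := D_Re Af.
have -> : w * (fun z => complex.Re (f z)) =
    2^-1 \*o (fun z => complex.Re (f z)) + c \*o (v * (fun z =>
      complex.Re (f z))).
  by apply/funext => z; rewrite /w !fctE /=; ring.
rewrite !lD ?lZ ?l_cst ?l_Re//; [|exact: D_mul|exact: D_scale|exact: D_scale|].
  by rewrite mulrDl => /addrI; rewrite -mulrA => /(mulfI c0).
by apply: D_scale; exact: D_mul.
Qed.

(** Since [l (v f) = l v f(x)] for all bounded [v], taking the real and
    imaginary parts of [f] for [v] gives [l |f|^2 = |f x|^2]: the mean [l] is
    concentrated at [x]. *)
Lemma representing_sqr_modulus f : A f -> f x = 0 ->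
  l (fun z => normc (f z) ^+ 2) = 0.
Proof.
move=> Af fx; have Af' : A (fun z => - 'i * f z) by exact: ua_scalel.
have Rf := weighted_multiplicative Af (D_Re Af).
have If := weighted_multiplicative Af' (D_Re Af').
have -> : (fun z => normc (f z) ^+ 2) =
   (fun z => complex.Re (f z)) * (fun z => complex.Re (f z)) +
   (fun z => complex.Re (- 'i * f z)) * (fun z => complex.Re (- 'i * f z)).
  apply/funext => z; rewrite normc_sqr !fctE.
  by rewrite -(congr1 (fun h => h z) (Re_mulNi f)) -!expr2.
rewrite lD ?Rf ?If ?fx ?mulr0 /= ?mulr0 ?addr0//; apply: D_mul; exact: D_Re.
Qed.

End RepresentingFunctional.

(** By the Hahn-Banach theorem the envelope at [|f|^2] is the value of some
    representing mean. *)
Lemma choquet_envelope x f : choquet_boundary A x -> A f -> f x = 0 ->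
  Q x (fun z => normc (f z) ^+ 2) = 0.
Proof.
move=> chx Af fx; have [K K1 fK] := ua_bound uaA compX Af.
have Df : D (fun z => normc (f z) ^+ 2).
  exists (K ^+ 2) => z; rewrite ger0_norm ?exprn_ge0 ?normc_ge0//.
  have K0 : 0 <= K by exact: le_trans K1.
  by apply: lerXn2r; rewrite ?nnegrE ?normc_ge0.
have [l [lD lZ lQ <-]] :=
  hahn_banach D_add D_scale (upper_envelope_sublinear x) Df.
exact: (representing_sqr_modulus chx).
Qed.

(** By compactness some [u] with vanishing envelope exceeds [1] outside [U].
    Hence some [f] in [A] satisfies [M u <= Re f] while [Re (f x)] is small.
    Once the imaginary part of [f x] is removed, [1 / (1 + f)] is small outside
    [U] and, normalized at [x], has norm at most [1 + e]. *)
Lemma choquet_peak_point x : choquet_boundary A x ->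
  generalized_peak_set A [set x].
Proof.
move=> chx U e oU xU e0.
have Ux : U x by exact: xU.
pose G := [set u | [/\ D u, continuous u, forall z, 0 <= u z & Q x u <= 0]].
pose F := [set [set z | u z <= 1] | u in G].
have sqG f : A f -> f x = 0 -> G (fun z => normc (f z) ^+ 2).
  move=> Af fx; split.
  - have [K K1 fK] := ua_bound uaA compX Af.
    exists (K ^+ 2) => z; rewrite ger0_norm ?exprn_ge0 ?normc_ge0//.
    have K0 : 0 <= K by exact: le_trans K1.
    by apply: lerXn2r; rewrite ?nnegrE ?normc_ge0.
  - move=> z; have cf : (fun z => normc (f z)) @ z --> normc (f z).
      exact: (@ua_continuous_normc _ _ _ uaA _ Af z).
    exact: (cvgM cf cf).
  - by move=> z; rewrite exprn_ge0// normc_ge0.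
  - by rewrite choquet_envelope.
have [|||||_ [u [Du cu u0 Qu] <-] uU] := @compact_directed _ compX F U.
- exists [set z | normc ((0 : X -> R[i]) z) ^+ 2 <= 1], (fun z =>
  normc ((0 : X -> R[i]) z) ^+ 2) => //.
  by apply: sqG => //; exact: (ua_cst uaA 0).
- move=> _ [u [_ cu _ _] <-].
  by apply: (@closed_comp _ _ u [set r | r <= 1]) => [z _|];
    [exact: cu|exact: closed_le].
- move=> _ _ [u [Du cu u0 Qu] <-] [v [Dv cv v0 Qv] <-].
  exists [set z | (u + v) z <= 1]; last first.
    by move=> z /=; rewrite !fctE => uv; split; have := u0 z; have := v0 z;
      rewrite /=; lra.
  exists (u + v) => //; split=> [|z|z|]; first exact: D_add.
  + by apply: cvgD; [exact: cu|exact: cv].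
  + by rewrite addr_ge0.
  + have [Qadd _] := upper_envelope_sublinear x.
    by apply: le_trans (Qadd _ _ Du Dv) _; lra.
- exact: oU.
- move=> z Fz; suff -> : z = x by [].
  apply: contrapT => zx; have [h Ah hz] := ua_separates uaA zx.
  pose f y := 2 / (h z - h x) * (h y - h x).
  have Af : A f.
    by apply: (ua_scalel uaA); exact: (ua_sub uaA Ah (ua_cst uaA (h x))).
  have fx : f x = 0 by rewrite /f subrr mulr0.
  have fz : f z = 2 by rewrite /f mulfVK// subr_eq0; apply/eqP.
  have := Fz _ (imageP _ (sqG _ Af fx)); rewrite /= fz normcMn normc1.
  by lra.
pose M := 2 / e; have M0 : 0 < M by rewrite divr_gt0.
pose e' := Num.min e 1; have e'0 : 0 < e' by rewrite lt_min e0 ltr01.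
have QM : Q x (M \*o u) < e'.
  have [_ Qscale] := upper_envelope_sublinear x.
  apply: le_lt_trans (Qscale _ _ M0 Du) _.
  by apply: le_lt_trans e'0; rewrite pmulr_rle0.
have [f [Af uf fx]] : exists f, [/\ A f, forall z, M * u z <= complex.Re (f z) &
    complex.Re (f x) < e'].
  apply: contrapT => nof; move: QM; rewrite ltNge => /negP; apply.
  apply: upper_envelope_ge => [|f Af uf]; first exact: D_scale.
  by rewrite leNgt; apply/negP => fx; apply: nof; exists f.
pose a := complex.Re (f x).
have Ref z : 0 <= complex.Re (f z)
  by rewrite (le_trans _ (uf z))// mulr_ge0// ltW.
pose f1 := f - cst ('i * (complex.Im (f x))%:C).
have Ref1 z : complex.Re (f1 z) = complex.Re (f z).
  by rewrite /f1 !fctE ReD ReN ReM /= mul0r mulr0 subr0 oppr0 addr0.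
have Af1 : A f1 by apply: ua_sub => //; exact: ua_cst.
have f1x : f1 x = a%:C.
  by apply: complex_ext;
    rewrite ?Ref1// /f1 !fctE ImD ImN ImM /= mul0r mul1r add0r subrr.
have Ah : A (fun z => (1 + f1 z)^-1).
  by apply: ua_invDRe => // z; rewrite Ref1.
have norm1 z : 1 + complex.Re (f z) <= normc (1 + f1 z).
  apply: le_trans (normc_Re _); rewrite ReD Ref1 /=; exact: ler_norm.
have a0 : 0 <= a := Ref x.
exists (fun z => (1 + a%:C) * (1 + f1 z)^-1).
have gE z : normc ((1 + a%:C) * (1 + f1 z)^-1) = (1 + a) / normc (1 + f1 z).
  by rewrite normcM normcV -(rmorphD (real_complex R) 1) normcr ger0_norm//
    addr_ge0.
have n0 z : 0 < normc (1 + f1 z)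
  by rewrite (lt_le_trans _ (norm1 z))// ltr_pwDl.
have [ae a1] : a < e /\ a < 1 by move: fx; rewrite lt_min => /andP[].
split=> [|_ ->|z|z Uz].
- exact: ua_scalel.
- by rewrite f1x mulfV// -f1x -normc_eq0 gt_eqF.
- rewrite gE ler_pdivrMr//; have := norm1 z; have := Ref z; nra.
- rewrite gE ler_pdivrMr//.
  have u1 : 1 < u z by rewrite ltNge; apply/negP => /uU.
  have Mu : M <= complex.Re (f z) by apply: le_trans (uf z);
    rewrite ler_peMr// ltW.
  have Me : M * e = 2 by rewrite /M mulfVK// gt_eqF.
  have := norm1 z; nra.
Qed.

End ChoquetPeak.

(** * Inclusion of peripheral spectra *)

Section PeripheralInclusion.
Context {R : realType} {X Y : topologicalType}.
Context {A : set (X -> R[i])} {B : set (Y -> R[i])}.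
Context {S : (X -> R[i]) -> (Y -> R[i])}.
Hypotheses (compX : compact [set: X]) (compY : compact [set: Y]).
Hypotheses (X0 : [set: X] !=set0) (Y0 : [set: Y] !=set0).
Hypotheses (uaA : uniform_algebra A) (uaB : uniform_algebra B).
Hypotheses (S_fun : set_fun A B S) (S_surj : set_surj A B S).
Hypothesis S_peripheral : forall f g, A f -> A g ->
  peripheral_spectrum B (S f * S g) `<=` peripheral_spectrum A (f * g).
Implicit Types (f g h : X -> R[i]) (x : X) (y : Y) (c : R).

Let SB f : A f -> B (S f). Proof. exact: S_fun. Qed.

Let S_onto k : B k -> exists2 f, A f & S f = k.
Proof. by move=> /S_surj[f Af <-]; exists f. Qed.

Let A1 : A 1. Proof. exact: ua_one. Qed.

(** The inclusion of peripheral spectra, stated in terms of values. *)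
Lemma peripheral_value f g y : A f -> A g ->
  (forall y', normc (S f y' * S g y') <= normc (S f y * S g y)) ->
  (exists x, f x * g x = S f y * S g y) /\
  forall x, normc (f x * g x) <= normc (S f y * S g y).
Proof.
move=> Af Ag ymax.
have ASB : B (S f * S g) by apply: (ua_mul uaB); exact: SB.
have Afg : A (f * g) by exact: (ua_mul uaA).
apply/(peripheral_spectrumP uaA compX X0 _ Afg)/S_peripheral => //.
by apply/(peripheral_spectrumP uaB compY Y0 _ ASB); split=> //; exists y.
Qed.

Let maxS f g : A f -> A g -> exists y,
  forall y', normc (S f y' * S g y') <= normc (S f y * S g y).
Proof.
move=> Af Ag; apply: (@max_modulus _ _ _ uaB compY Y0 (S f * S g)).
by apply: (ua_mul uaB); exact: SB.
Qed.

Lemma norm_mul_le_source f g c : A f -> A g ->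
  (forall y, normc (S f y * S g y) <= c) -> forall x, normc (f x * g x) <= c.
Proof.
move=> Af Ag fgc x; have [y ymax] := maxS Af Ag.
have [_ /(_ x) fgy] := peripheral_value Af Ag ymax.
exact: le_trans fgy (fgc y).
Qed.

Lemma norm_mul_le_target f g c : A f -> A g ->
  (forall x, normc (f x * g x) <= c) -> forall y, normc (S f y * S g y) <= c.
Proof.
move=> Af Ag fgc y; have [y0 ymax] := maxS Af Ag.
have [[x fgx] _] := peripheral_value Af Ag ymax.
by apply: le_trans (ymax y) _; rewrite -fgx.
Qed.

Lemma norm_le1_source g : A g -> (forall y, normc (S g y) <= 1) ->
  forall x, normc (g x) <= 1.
Proof.
move=> Ag Sg1 x.
have : normc (g x * g x) <= 1.
  apply: norm_mul_le_source => // y; rewrite normcM mulr_ile1 ?normc_ge0//.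
by rewrite normcM -expr2 expr_le1// normc_ge0.
Qed.

(** A function [g] peaking at [x] and damping [f] to norm about [|f x|] yields
    [|h x| <= |h g| <= c |f g|], since the norms of products agree on both
    sides. *)
Lemma modulus_dominated f h c x : A f -> A h -> 0 <= c ->
  (forall y, normc (S h y) <= c * normc (S f y)) ->
  generalized_peak_set A [set x] -> normc (h x) <= c * normc (f x).
Proof.
move=> Af Ah c0 hf peakx.
apply/ler_addgt0Pr => e e0; pose e' := e / (c + 1).
have e'0 : 0 < e' by rewrite divr_gt0// ltr_wpDl.
have fx0 : 0 < normc (f x) + e' by rewrite ltr_wpDl// normc_ge0.
have [|g [Ag g1 gle fg]] := bishop uaA compX peakx Af fx0.
  by move=> _ ->; rewrite lerDl ltW.
have Sfg := norm_mul_le_target Af Ag fg.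
have Shg y : normc (S h y * S g y) <= c * (normc (f x) + e').
  rewrite normcM; apply: (@le_trans _ _ (c * normc (S f y) * normc (S g y))).
    by rewrite ler_wpM2r ?normc_ge0.
  by rewrite -mulrA -normcM ler_wpM2l.
have := norm_mul_le_source Ah Ag Shg x; rewrite g1// mulr1.
move=> /le_trans; apply;
  rewrite mulrDr lerD2l /e' mulrA ler_pdivrMr ?ltr_wpDl//.
by rewrite mulrC ler_pM2l// lerDl.
Qed.

(** If [S h] has norm [1] and modulus [1] at [y], then [h] has norm at least
    [1], so the set [K h] of peak points where [|h| >= 1] is nonempty. For
    [S h = S h1 * S h2] domination of moduli gives [K h] inside [K h1] and
    [K h2]; by compactness the closures of all the [K h] have a common point.
    When [S h] is [S f] damped at [y], [|f|] is at least [|S f y|] on [K h], and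
    so at the common point. *)
Lemma modulus_point y : generalized_peak_set B [set y] ->
  exists x, forall f, A f -> normc (f x) = normc (S f y).
Proof.
move=> peaky.
pose G := [set h | [/\ A h, forall y', normc (S h y')
  <= 1 & normc (S h y) = 1]].
pose K h := [set x | generalized_peak_set A [set x] /\ 1 <= normc (h x)].
have GK h : G h -> K h !=set0.
  move=> [Ah _ hy]; have [x peakx xmax] := peak_point_max uaA compX X0 Ah.
  exists x; split=> //; rewrite leNgt; apply/negP => hx1.
  have : normc (S h y * S h y) <= normc (h x) * normc (h x).
    apply: norm_mul_le_target => // x'.
    by rewrite normcM ler_pM ?normc_ge0.
  by rewrite normcM hy; have := normc_ge0 (h x); nra.
have bishopG f : A f -> S f y != 0 -> exists2 h, G h &
    forall x, K h x -> normc (S f y) <= normc (f x).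
  move=> Af fy0; have fy : 0 < normc (S f y)
    by rewrite lt_def normc_ge0 normc_eq0 fy0.
  have [|k [Bk k1 kle fk]] := bishop uaB compY peaky (SB Af) fy;
    first by move=> _ ->.
  have [h Ah Sh] := S_onto (ua_scalel uaB (S f y)^-1 (ua_mul uaB (SB Af) Bk)).
  have ShE y' : normc (S h y') = normc (S f y' * k y') / normc (S f y).
    by rewrite Sh normcM normcV mulrC.
  exists h.
    split=> // [y'|]; first by rewrite ShE ler_pdivrMr ?mul1r.
    by rewrite ShE k1// mulr1 divff// gt_eqF.
  move=> x [peakx hx].
  have : normc (h x) <= (normc (S f y))^-1 * normc (f x).
    apply: modulus_dominated => //; first by rewrite invr_ge0 normc_ge0.
    move=> y'; rewrite ShE normcM mulrC ler_wpM2l ?invr_ge0 ?normc_ge0//.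
    by rewrite ler_piMr ?normc_ge0.
  by move=> /(le_trans hx); rewrite mulrC ler_pdivlMr ?mul1r.
have [x xP] : exists x, forall h, G h -> closure (K h) x.
  apply: contrapT => nox.
  pose F := [set closure (K h) | h in G].
  have [|||||_ [h Gh <-] K0] := @compact_directed _ compX F set0.
  - have [h Ah Sh] := S_onto (ua_one uaB); exists (closure (K h)), h => //.
    by split=> // [y'|]; rewrite Sh [X in normc X](_ : _ = 1)// normc1.
  - by move=> _ [h _ <-]; exact: closed_closure.
  - move=> _ _ [h1 [Ah1 h1le h1y] <-] [h2 [Ah2 h2le h2y] <-].
    have [h Ah Sh] := S_onto (ua_mul uaB (SB Ah1) (SB Ah2)).
    have ShE y' : normc (S h y') = normc (S h1 y') * normc (S h2 y').
      by rewrite Sh normcM.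
    have Kh12 x : K h x -> K h1 x /\ K h2 x.
      move=> [peakx hx]; split; split=> //; apply: le_trans hx _.
        rewrite -[leRHS]mul1r; apply: modulus_dominated => // y'.
        by rewrite ShE mul1r ler_piMr ?normc_ge0.
      rewrite -[leRHS]mul1r; apply: modulus_dominated => // y'.
      by rewrite ShE mul1r ler_piMl ?normc_ge0.
    exists (closure (K h)).
      exists h => //; split=> // [y'|]; last by rewrite ShE h1y h2y mulr1.
      by rewrite ShE mulr_ile1 ?normc_ge0.
    by move=> x cx; split; apply: closure_subset cx => z /Kh12[].
  - exact: open0.
  - by move=> x capx; apply: nox; exists x => h Gh; apply: capx; exists h.
  - have [x Kx] := GK _ Gh; by apply: (K0 x); exact: subset_closure.
have ge f : A f -> normc (S f y) <= normc (f x).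
  move=> Af; have [->|fy] := eqVneq (S f y) 0;
    first by rewrite normc0 normc_ge0.
  have [h Gh Kh] := bishopG f Af fy.
  have clf : closed [set z | normc (S f y) <= normc (f z)].
    rewrite -[X in closed X]setCK; apply: open_closedC.
    rewrite (_ : ~` _ = [set z | normc (f z) < normc (S f y)]).
      exact: (open_modulus_lt uaA).
    by apply/seteqP; split=> z /=; rewrite ltNge => /negP.
  by apply: clf; exact: closure_subset Kh _ (xP _ Gh).
(* For the converse, [g] with [S g] damping [S f] has [|g x| >= 1]. *)
exists x => f Af; apply/eqP; rewrite eq_le ge// andbT.
apply/ler_addgt0Pr => e e0.
have fy0 : 0 < normc (S f y) + e by rewrite ltr_wpDl// normc_ge0.
have [|k [Bk k1 kle fk]] := bishop uaB compY peaky (SB Af) fy0.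
  by move=> _ ->; rewrite lerDl ltW.
have [g Ag Sg] := S_onto Bk.
have gx : 1 <= normc (g x) by have := ge _ Ag; rewrite Sg k1// normc1.
have : normc (f x * g x) <= normc (S f y) + e.
  by apply: norm_mul_le_source => // y'; rewrite Sg.
by rewrite normcM; apply: le_trans; rewrite ler_peMr ?normc_ge0.
Qed.

Lemma square_one_at_peak y : generalized_peak_set B [set y] ->
  S 1 y * S 1 y = 1.
Proof.
move=> peaky; have [x xE] := modulus_point peaky.
have S1y : normc (S 1 y) = 1
  by rewrite -xE// [X in normc X](_ : _ = 1)// normc1.
have [|[x' <-] _] := @peripheral_value 1 1 y A1 A1; last by rewrite mulr1.
move=> y'; rewrite [leRHS]normcM S1y mulr1.
apply: norm_mul_le_target => // x'.
by rewrite [X in normc X](_ : _ = 1 * 1)// mulr1 normc1.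
Qed.

(** Pull back a function damping [S f] at [y] to some [g] in [A], normalized to
    [p x = 1]; the modulus equality makes [p] damp [f] at [x]. Averaging [p] and
    [f p / f x] with [1] gives [G] such that [1] is the only value of maximal
    modulus of [G], and [f x] that of [f G]. The inclusions for the pairs
    [(G, 1)] and [(f, G)] then read [S G y * S 1 y = 1] and
    [S f y * S G y = f x]. *)
Lemma multiplier_at_peak y : generalized_peak_set B [set y] ->
  exists x, forall f, A f -> S f y = S 1 y * f x.
Proof.
move=> peaky; have [x xE] := modulus_point peaky.
have S1y := square_one_at_peak peaky.
exists x => f Af; have [f0|fx0] := eqVneq (f x) 0.
  by rewrite f0 mulr0; apply/eqP; rewrite -normc_eq0 -xE// f0 normc0.
have fx : 0 < normc (f x) by rewrite lt_def normc_ge0 normc_eq0 fx0.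
have [|k [Bk k1 kle fk]] := bishop uaB compY peaky (SB Af) fx.
  by move=> _ ->; rewrite -xE.
have [g Ag Sg] := S_onto Bk.
have gx1 : normc (g x) = 1 by rewrite xE// Sg k1// normc1.
have gx0 : g x != 0 by rewrite -normc_eq0 gx1 oner_neq0.
have gle z : normc (g z) <= 1 by apply: norm_le1_source => // y'; rewrite Sg.
have fgle z : normc (f z * g z) <= normc (f x).
  by apply: norm_mul_le_source => // y'; rewrite Sg.
pose p z := (g x)^-1 * g z.
pose w z := (f x)^-1 * (f z * p z).
pose G z := p z * ((1 + w z) / 2) * ((1 + p z) / 2).
have Ap : A p by exact: (ua_scalel uaA).
have Aw : A w by apply: (ua_scalel uaA); exact: (ua_mul uaA Af Ap).
have Aavg h : A h -> A (fun z => (1 + h z) / 2).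
  move=> Ah; have := ua_scalel uaA 2^-1 (ua_add uaA A1 Ah).
  by congr (A _); apply/funext => z; rewrite mulrC.
have AG : A G by apply: (ua_mul uaA (ua_mul uaA Ap (Aavg _ Aw)) (Aavg _ Ap)).
have ple z : normc (p z) <= 1 by rewrite normcM normcV gx1 invr1 mul1r.
have wle z : normc (w z) <= 1.
  have -> : w z = (g x)^-1 * ((f x)^-1 * (f z * g z)) by rewrite /w /p; ring.
  by rewrite normcM normcV gx1 invr1 mul1r normcM normcV mulrC ler_pdivrMr
    ?mul1r.
have px : p x = 1 by rewrite /p mulVf.
have wx : w x = 1 by rewrite /w px mulr1 mulVf.
have two1 : (1 + 1) / 2 = 1 :> R[i] by rewrite divff// pnatr_eq0.
have Gx : G x = 1 by rewrite /G px wx two1 !mulr1.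
have pavg z := normc_avg_le1 (ple z).
have wavg z := normc_avg_le1 (wle z).
have Gle z : normc (G z) <= normc (p z).
  by rewrite /G -mulrA normcM -[leRHS]mulr1 ler_wpM2l ?normc_ge0// normcM_le1.
have Gle1 z : normc (G z) <= 1 by exact: le_trans (Gle z) (ple z).
have avgs1 z : 1 <= normc ((1 + w z) / 2) * normc ((1 + p z) / 2) ->
    p z = 1 /\ w z = 1.
  have [wa pa] := conj (wavg z) (pavg z).
  move=> prod1; split; apply: avg_eq1 => //.
    by apply: le_trans prod1 _; rewrite ler_piMl ?normc_ge0.
  by apply: le_trans prod1 _; rewrite ler_piMr ?normc_ge0.
have SG1 : S G y * S 1 y = 1.
  have nG : normc (S G y * S 1 y) = 1.
    by rewrite normcM -!xE// Gx normc1 mul1r.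
  have [|[z Gz] _] := @peripheral_value G 1 y AG A1.
    move=> y'; rewrite nG; apply: norm_mul_le_target => // z.
    by rewrite mulr1.
  move: nG; rewrite -Gz mulr1 => nG.
  have [|pz wz] := avgs1 z.
    by rewrite -nG -normcM /G -mulrA [leLHS]normcM ler_piMl ?normc_ge0.
  by rewrite /G pz wz two1 !mulr1.
have SfG : S f y * S G y = f x.
  have nfG : normc (S f y * S G y) = normc (f x).
    by rewrite normcM -!xE// Gx normc1 mulr1.
  have fGE z : f z * G z = f x * (w z * ((1 + w z) / 2) * ((1 + p z) / 2)).
    by rewrite /G /w !mulrA mulfV// mul1r.
  have [|[z Gz] _] := @peripheral_value f G y Af AG.
    move=> y'; rewrite nfG; apply: norm_mul_le_target => // z.
    rewrite fGE normcM -[leRHS]mulr1 ler_wpM2l ?normc_ge0//.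
    by apply: normcM_le1; first exact: normcM_le1.
  move: nfG; rewrite -Gz fGE normcM -[RHS]mulr1 => /(mulfI (lt0r_neq0 fx)).
  move=> nwa; have [|pz wz] := avgs1 z.
    by rewrite -nwa -normcM -mulrA [leLHS]normcM ler_piMl ?normc_ge0.
  by rewrite pz wz two1 !mulr1.
have SGy : S G y = S 1 y.
  by rewrite -[LHS]mulr1 -S1y mulrA SG1 mul1r.
by rewrite -SfG SGy mulrC -mulrA S1y mulr1.
Qed.
Lemma peripheral_isometry f : A f -> supnorm (S f) = supnorm f.
Proof.
move=> Af; have [x xmax] := max_modulus uaA compX X0 Af.
have [y ymax] := max_modulus uaB compY Y0 (SB Af).
have [x0 y0] := conj (normc_ge0 (f x)) (normc_ge0 (S f y)).
rewrite (supnormE xmax) (supnormE ymax); apply/eqP; rewrite eq_le.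
apply/andP; split; rewrite -(@ler_pXn2r _ 2) ?nnegrE// !expr2 -normcM.
  by apply: norm_mul_le_target => // z; rewrite normcM ler_pM ?normc_ge0.
by apply: norm_mul_le_source => // z; rewrite normcM ler_pM ?normc_ge0.
Qed.

End PeripheralInclusion.

(** * Isomorphisms and composition operators *)

Section Isomorphisms.
Context {R : realType} {X Y : topologicalType}.
Context {A : set (X -> R[i])} {B : set (Y -> R[i])}.
Hypotheses (compX : compact [set: X]) (compY : compact [set: Y]).
Hypotheses (X0 : [set: X] !=set0) (Y0 : [set: Y] !=set0).
Hypotheses (uaA : uniform_algebra A) (uaB : uniform_algebra B).
Implicit Types (f : X -> R[i]) (g : Y -> R[i]).

Lemma iai_inverse (T : (X -> R[i]) -> (Y -> R[i])) :
  isometric_algebra_isomorphism A B T -> exists T',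
  [/\ isometric_algebra_isomorphism B A T', forall f, A f -> T' (T f) = f &
    forall g, B g -> T (T' g) = g].
Proof.
move=> isoT; have [Tfun Tinj Tsurj] := iai_bij isoT.
have [T' T'P] : exists T', forall g, B g -> A (T' g) /\ T (T' g) = g.
  suff /choice[T' T'P] : forall g, exists f, B g -> A f /\ T f = g by exists T'.
  move=> g; have [/Tsurj[f Af Tf]|nBg] := pselect (B g); first by exists f.
  by exists 0.
have T'A g : B g -> A (T' g) by move=> /T'P[].
have TT' g : B g -> T (T' g) = g by move=> /T'P[].
have TB f : A f -> B (T f) by move=> Af; exact: Tfun.
have T'T f : A f -> T' (T f) = f.
  by move=> Af; apply: Tinj; rewrite ?inE ?TT'//; auto.
have unique f g : A f -> B g -> T f = g -> T' g = f by move=> Af Bg <-;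
  exact: T'T.
exists T'; split=> //; split.
- split=> [g Bg|g h|f Af].
  + exact: T'A.
  + by rewrite !inE => Bg Bh T'gh; rewrite -(TT' g)// T'gh TT'.
  + by exists (T f); [exact: TB|exact: T'T].
- move=> g h Bg Bh; have [Ag Ah] := conj (T'A _ Bg) (T'A _ Bh).
  apply: unique; first exact: (ua_add uaA).
    exact: (ua_add uaB).
  by rewrite (iai_add isoT)// !TT'.
- move=> c g Bg; have Ag := T'A _ Bg.
  apply: unique; first exact: (ua_scale uaA).
    exact: (ua_scale uaB).
  by rewrite (iai_scale isoT)// !TT'.
- move=> g h Bg Bh; have [Ag Ah] := conj (T'A _ Bg) (T'A _ Bh).
  apply: unique; first exact: (ua_mul uaA).
    exact: (ua_mul uaB).
  by rewrite (iai_mul isoT)// !TT'.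
- by apply: unique; [exact: ua_one|exact: ua_one|exact: (iai_one isoT)].
- by move=> g Bg; rewrite -{2}(TT' _ Bg) (iai_isometry isoT)//; exact: T'A.
Qed.

Lemma iai_peripheral_spectrum (T : (X -> R[i]) -> (Y -> R[i])) f :
  isometric_algebra_isomorphism A B T -> A f ->
  peripheral_spectrum B (T f) = peripheral_spectrum A f.
Proof.
move=> isoT Af.
suff sE : spectrum B (T f) = spectrum A f.
  by rewrite /peripheral_spectrum /spectral_radius sE.
have [T' [isoT' T'T TT']] := iai_inverse isoT.
have [Tfun _ _] := iai_bij isoT; have [T'fun _ _] := iai_bij isoT'.
have cstE z : T (f - cst z) = T f - cst z.
  have cstX : cst z = z *: (1 : X -> R[i]).
    by apply/funext => x /=; rewrite -[RHS]/(z * 1) mulr1.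
  have cstY : cst z = z *: (1 : Y -> R[i]).
    by apply/funext => x /=; rewrite -[RHS]/(z * 1) mulr1.
  rewrite cstX cstY -!scaleNr (iai_add isoT)//; last first.
    by apply: (ua_scale uaA); exact: ua_one.
  by rewrite (iai_scale isoT) ?(iai_one isoT)//; exact: ua_one.
have Afz z : A (f - cst z) by apply: ua_sub => //; exact: (ua_cst uaA).
apply/seteqP; split=> z nz [h Ah hE]; apply: nz.
  exists (T h); first exact: Tfun.
  by rewrite -cstE -(iai_mul isoT)// hE (iai_one isoT).
exists (T' h); first exact: T'fun.
rewrite -(T'T _ (Afz z)) cstE -(iai_mul isoT')// ?hE ?(iai_one isoT')//.
by rewrite -cstE; exact: Tfun.
Qed.

(** Composition with the inverse of [T] turns states of [A] into states of [B],
    so extremality passes from [y] to [x]. *)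
Lemma choquet_transport (T : (X -> R[i]) -> (Y -> R[i])) x y :
  isometric_algebra_isomorphism A B T -> choquet_boundary B y ->
  (forall f, A f -> T f y = f x) -> choquet_boundary A x.
Proof.
move=> isoT [_ exty] Tyx; split; first exact: eval_state.
have [T' [isoT' T'T TT']] := iai_inverse isoT.
have [Tfun _ _] := iai_bij isoT; have [T'fun _ _] := iai_bij isoT'.
have sT' L : state A L -> state B (L \o T').
  move=> sL; split=> [c f g Bf Bg|f Bf|] /=.
  - have [Af Ag] := conj (T'fun _ Bf) (T'fun _ Bg).
    have Bcf : B (c *: f) by exact: ua_scale.
    by rewrite (iai_add isoT')// (iai_scale isoT')// (state_linear sL).
  - rewrite -(iai_isometry isoT' Bf); apply: (state_bounded sL).
    exact: T'fun.
  - by rewrite (iai_one isoT') (state_one sL).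
move=> t L1 L2 t01 s1 s2 xE f Af.
have [|L1f L2f] := exty t _ _ t01 (sT' _ s1) (sT' _ s2) _ (T f) (Tfun _ Af).
  by move=> g Bg /=; rewrite -xE ?TT' -?Tyx//;
    [rewrite TT'|exact: T'fun|exact: T'fun].
by move: L1f L2f; rewrite /= T'T// Tyx.
Qed.

(** On a compact space, a separating algebra of continuous functions determines
    the topology, so continuity can be tested on the functions [f \o phi]. *)
Lemma continuous_into (P : set Y) (phi : Y -> X) :
  (forall f, A f -> exists2 g, B g & forall y, P y -> g y = f (phi y)) ->
  {within P, continuous phi}.
Proof.
move=> phiA; apply/subspace_continuousP => y Py U;
  rewrite nbhsE => -[V [oV Vy] VU].
(* The images of the traces on [P] of the neighborhoods of [y] shrink to
   [phi y]. *)
have pullback f (e : R) : A f -> 0 < e -> exists2 W, nbhs y W &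
    forall z, W z -> P z -> normc (f (phi z) - f (phi y)) < e.
  move=> Af e0; have [g Bg gP] := phiA f Af.
  pose h := g - cst (g y).
  have Bh : B h by apply: ua_sub => //; exact: (ua_cst uaB).
  exists [set z | normc (h z) < e].
    apply: open_nbhs_nbhs; split; first exact: (open_modulus_lt uaB).
    by rewrite /= /h !fctE subrr normc0.
  by move=> z /=; rewrite /h !fctE => hz Pz; rewrite -!gP.
pose F := [set closure [set phi z | z in W `&` P] | W in nbhs y].
have [|||||_ [W yW <-] WV] := @compact_directed _ compX F V.
- by exists (closure [set phi z | z in setT `&` P]), setT => //; exact: filterT.
- by move=> _ [W _ <-]; exact: closed_closure.
- move=> _ _ [W1 yW1 <-] [W2 yW2 <-].
  exists (closure [set phi z | z in (W1 `&` W2) `&` P]).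
    by exists (W1 `&` W2) => //; exact: filterI.
  by move=> x cx; split; apply: closure_subset cx => _ [z [[W1z W2z] Pz] <-];
    exists z.
- exact: oV.
- move=> x Fx; suff -> : x = phi y by [].
  apply: contrapT => /(ua_separates uaA)[f Af fx].
  have e0 : 0 < normc (f x - f (phi y)).
    by rewrite lt_def normc_ge0 normc_eq0 subr_eq0 andbT; apply/eqP.
  pose e := normc (f x - f (phi y)) / 2.
  have e1 : 0 < e by rewrite divr_gt0.
  have [W yW Wf] := pullback f e Af e1.
  pose h := f - cst (f (phi y)).
  have Ah : A h by apply: ua_sub => //; exact: (ua_cst uaA).
  have cl : closed [set z | normc (h z) <= e].
    apply: (@closed_comp _ _ (fun z => normc (h z)) [set r | r <= e]).
      by move=> z _; exact: (@ua_continuous_normc _ _ _ uaA _ Ah z).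
    exact: closed_le.
  have : closure [set phi z | z in W `&` P] x by apply: Fx; exists W.
  move=> /(@closure_subset _ _ [set z | normc (h z) <= e]) => hx.
  have : normc (h x) <= e.
    apply: cl; apply: hx => _ [z [Wz Pz] <-] /=.
    by rewrite /h !fctE ltW// Wf.
  by rewrite /h !fctE /e; lra.
rewrite nbhs_simpl /=; apply: filterS yW => z Wz Pz; apply/VU/WV.
by apply: subset_closure; exists z.
Qed.

(** The difference attains its maximum modulus at a peak point. *)
Lemma eq_on_boundary g h : B g -> B h ->
  (forall y, generalized_peak_set B [set y] -> g y = h y) -> g = h.
Proof.
move=> Bg Bh gh; have Bgh : B (g - h) by exact: ua_sub.
have [y peaky ymax] := peak_point_max uaB compY Y0 Bgh.
apply/funext => z; apply: subr0_eq; apply/eqP;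
  rewrite -normc_eq0 eq_le normc_ge0 andbT.
by apply: le_trans (ymax z) _; rewrite fctE gh// subrr normc0.
Qed.

(** A map that is a composition operator on the peak points of [B] inherits the
    algebraic operations of [A], because these points determine the functions of
    [B]. *)
Lemma composition_isomorphism (T : (X -> R[i]) -> (Y -> R[i])) :
  set_fun A B T -> set_surj A B T ->
  (forall y, generalized_peak_set B [set y] ->
    exists x, forall f, A f -> T f y = f x) ->
  (forall f, A f -> supnorm (T f) = supnorm f) ->
  isometric_algebra_isomorphism A B T.
Proof.
move=> Tfun Tsurj Tcomp Tnorm.
have TB f : A f -> B (T f) by move=> Af; exact: Tfun.
have TD f h : A f -> A h -> T (f + h) = T f + T h.
  move=> Af Ah; apply: eq_on_boundary => [||y /Tcomp[x xE]].
  - by apply: TB; exact: ua_add.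
  - by apply: (ua_add uaB); exact: TB.
  - by rewrite -[RHS]/(T f y + T h y) !xE//; exact: ua_add.
have TZ c f : A f -> T (c *: f) = c *: T f.
  move=> Af; apply: eq_on_boundary => [||y /Tcomp[x xE]].
  - by apply: TB; exact: ua_scale.
  - by apply: (ua_scale uaB); exact: TB.
  - by rewrite -[RHS]/(c * T f y) !xE//; exact: ua_scale.
split=> // [|f g Af Ag|].
- split=> // f g; rewrite !inE => Af Ag Tfg.
  have Afg : A (f - g) by exact: ua_sub.
  have T0 : T (f - g) = 0.
    have Ag' : A (-1 *: g) by exact: ua_scale.
    by rewrite -scaleN1r TD// TZ// Tfg scaleN1r subrr.
  have [x xmax] := max_modulus uaA compX X0 Afg.
  have := Tnorm _ Afg; rewrite (supnormE xmax) T0.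
  have [y _] := Y0.
  rewrite (_ : supnorm 0 = normc ((0 : Y -> R[i]) y)); last exact: supnormE.
  rewrite [LHS]normc0 => fgx.
  apply/funext => z; apply: subr0_eq; apply/eqP.
  by rewrite -normc_eq0 eq_le normc_ge0 andbT fgx xmax.
- apply: eq_on_boundary => [||y /Tcomp[x xE]].
  + by apply: TB; exact: ua_mul.
  + by apply: (ua_mul uaB); exact: TB.
  + by rewrite -[RHS]/(T f y * T g y) !xE//; exact: ua_mul.
- apply: eq_on_boundary => [||y /Tcomp[x xE]].
  + by apply: TB; exact: ua_one.
  + exact: ua_one.
  + by rewrite xE//; exact: ua_one.
Qed.

End Isomorphisms.

(** * The representation theorem *)

Theorem corollary7p3 (R : realType) (X Y : topologicalType)
    (A : set (X -> R[i])) (B : set (Y -> R[i]))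
    (S : (X -> R[i]) -> (Y -> R[i]))
    (hausX : hausdorff_space X) (compX : compact [set: X])
    (hausY : hausdorff_space Y) (compY : compact [set: Y])
    (Y_nonempty : [set: Y] !=set0)
    (uaA : uniform_algebra A) (uaB : uniform_algebra B)
    (S_fun : set_fun A B S) (S_surj : set_surj A B S)
    (S_peripheral : forall f g : X -> R[i], A f -> A g ->
      peripheral_spectrum B (S f * S g) `<=` peripheral_spectrum A (f * g)) :
  [/\ S 1 ^+ 2 = 1,
      exists phi : Y -> X,
        homeomorphism_on (choquet_boundary B) (choquet_boundary A) phi /\
        (forall f : X -> R[i], A f ->
          forall y : Y, choquet_boundary B y -> S f y = S 1 y * f (phi y)) &
      isometric_algebra_isomorphism A B
        (fun (f : X -> R[i]) (y : Y) => S f y / S 1 y)].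
Proof.
have A1 := ua_one uaA.
have S1B : B (S 1) := S_fun _ A1.
(* Over an empty [X], the map [S] could not have both [0] and [1] as values. *)
have X0 : [set: X] !=set0.
  apply: contrapT => noX; have [y _] := Y_nonempty.
  have [f _ Sf] := S_surj _ (ua_cst uaB 0).
  have [g _ Sg] := S_surj _ (ua_cst uaB 1).
  have fg : f = g by apply/funext => x; case: noX; exists x.
  have /eqP := congr1 (fun h => h y) Sg.
  by rewrite -fg Sf /= eq_sym oner_eq0.
have S1sq : S 1 ^+ 2 = 1.
  apply: (eq_on_boundary compY Y_nonempty uaB).
  - exact: ua_exp.
  - exact: ua_one.
  - move=> y peaky; rewrite fct_expE expr2.
    exact: (square_one_at_peak compX compY X0 Y_nonempty uaA uaB S_fun S_surj
      S_peripheral).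
have S1y y : S 1 y * S 1 y = 1 := congr1 (fun h => h y) S1sq.
have S1y0 y : S 1 y != 0.
  by apply/eqP => S0; have /eqP := S1y y; rewrite S0 mul0r eq_sym oner_eq0.
have S1V y : (S 1 y)^-1 = S 1 y by apply: (mulfI (S1y0 y)); rewrite mulfV.
have S1norm y : normc (S 1 y) = 1.
  have /eqP := congr1 (@normc R) (S1y y).
  by rewrite normcM normc1 -expr2 sqrp_eq1 ?normc_ge0// => /eqP.
pose T f y := S f y / S 1 y.
have TE f : T f = S f * S 1 by apply/funext => y; rewrite /T S1V.
have Tcomp y : generalized_peak_set B [set y] ->
    exists x, forall f, A f -> T f y = f x.
  move=> peaky; have [x xE] := multiplier_at_peak compX compY X0 Y_nonempty
    uaA uaB S_fun S_surj S_peripheral peaky.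
  by exists x => f Af; rewrite /T xE// mulrAC mulfV ?mul1r.
have isoT : isometric_algebra_isomorphism A B T.
  apply: (composition_isomorphism compX compY X0 Y_nonempty uaA uaB) => //.
  - by move=> f Af; rewrite TE; apply: ua_mul => //; exact: S_fun.
  - move=> g Bg; have [f Af Sf] := S_surj _ (ua_mul uaB Bg S1B).
    exists f => //; rewrite TE Sf; apply/funext => y.
    by rewrite !fctE -mulrA S1y mulr1.
  - move=> f Af; rewrite -(peripheral_isometry compX compY X0 Y_nonempty uaA uaB
      S_fun S_peripheral Af).
    rewrite /supnorm (_ : (fun y => normc (T f y)) = fun y => normc (S f y))//.
    by apply/funext => y; rewrite /T normcM normcV S1norm invr1 mulr1.
split=> //.
have [T' [isoT' T'T TT']] := iai_inverse uaA uaB isoT.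
have [Tfun _ _] := iai_bij isoT; have [T'fun _ T'surj] := iai_bij isoT'.
(* The inverse of [T] preserves spectra, so it has a representing map [psi] as
   well, which will be inverse to [phi]. *)
have T'_peripheral g h : B g -> B h ->
    peripheral_spectrum A (T' g * T' h) `<=` peripheral_spectrum B (g * h).
  move=> Bg Bh; have Bgh := ua_mul uaB Bg Bh.
  by rewrite -(iai_mul isoT')// (iai_peripheral_spectrum uaB uaA isoT').
(* Default values outside the Choquet boundaries. *)
have [[x0 _] [y0 _]] := conj X0 Y_nonempty.
have /choice[phi phiP] : forall y, exists x, choquet_boundary B y ->
    forall f, A f -> T f y = f x.
  move=> y; have [chy|nchy] := pselect (choquet_boundary B y);
    last by exists x0.
  by have [x xE] := Tcomp y (choquet_peak_point uaB compY chy); exists x.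
have /choice[psi psiP] : forall x, exists y, choquet_boundary A x ->
    forall g, B g -> T' g x = g y.
  move=> x; have [chx|nchx] := pselect (choquet_boundary A x);
    last by exists y0.
  have [y yE] := multiplier_at_peak compY compX Y_nonempty X0 uaB uaA T'fun
    T'surj T'_peripheral (choquet_peak_point uaA compX chx).
  by exists y => _ g Bg; rewrite yE// (iai_one isoT') mul1r.
exists phi; split; last first.
  by move=> f Af y chy; rewrite -phiP// /T mulrCA mulfV// mulr1.
have phi_ch : set_fun (choquet_boundary B) (choquet_boundary A) phi.
  by move=> y chy; apply: (choquet_transport compX uaA uaB isoT chy);
    exact: phiP.
have psi_ch : set_fun (choquet_boundary A) (choquet_boundary B) psi.
  by move=> x chx; apply: (choquet_transport compY uaB uaA isoT' chx);
    exact: psiP.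
have separated (Z : topologicalType) (C : set (Z -> R[i])) (z z' : Z) :
    uniform_algebra C -> (forall f, C f -> f z = f z') -> z = z'.
  move=> uaC zz'; apply: contrapT => /(ua_separates uaC)[f Cf].
  by apply; exact: zz'.
split=> //.
  apply: (continuous_into compX uaA uaB) => f Af.
  by exists (T f) => [|y chy]; [exact: Tfun|exact: phiP].
exists psi; split=> //.
- apply: (continuous_into compY uaB uaA) => g Bg.
  by exists (T' g) => [|x chx]; [exact: T'fun|exact: psiP].
- move=> y; rewrite inE => chy; apply: (separated _ _ _ _ uaB) => g Bg.
  rewrite -psiP//; last exact: phi_ch.
  by rewrite -phiP ?TT'//; exact: T'fun.
- move=> x; rewrite inE => chx; apply: (separated _ _ _ _ uaA) => f Af.
  rewrite -phiP//; last exact: psi_ch.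
  by rewrite -psiP ?T'T//; exact: Tfun.
Qed.
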